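(* Let $d\ge1$ and $\lambda\in(0,2)$. For $T,a,\gamma>0$ and $\alpha\in(0,2)$ let $u^\alpha$ be the solution of $$\partial_t u+a\,(-\triangle)^{\alpha/2}u=0,\qquad u(x,0)=\gamma\,\mathbf{1}_Q(\gamma^{-1}x),\qquad Q:=[-1,1]^d,$$ and set $M:=T\,a$, $$\mathrm{Lip}_\alpha(u;\lambda):=\limsup_{\alpha,\beta\to\lambda}\frac{\|u^\alpha-u^\beta\|_{C([0,T];L^1)}}{|\alpha-\beta|},$$ $$\tilde\sigma_M:=\begin{cases}M^{1/\lambda}\,|\ln M|,&\lambda>1,\\ M\ln^2M,&\lambda=1,\\ M,&\lambda<1,\end{cases}\qquad \tilde\sigma_\gamma:=\begin{cases}\gamma^d,&\lambda>1,\\ \gamma^d\ln^2\gamma,&\lambda=1,\\ \gamma^{d+1-\lambda}\ln\gamma,&\lambda<1.\end{cases}$$ Then there exist $M_0,\gamma_0>0$ such that: (i) for all $\gamma$ with $\gamma_0\ge\gamma>0$, $\displaystyle\liminf_{M\downarrow0}\frac{\mathrm{Lip}_\alpha(u;\lambda)}{\tilde\sigma_M}>0$; (ii) for all $M$ with $M_0\ge M>0$, $\displaystyle\liminf_{\gamma\to+\infty}\frac{\mathrm{Lip}_\alpha(u;\lambda)}{\tilde\sigma_\gamma}>0$.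
   Context: The solution $u^\alpha$ is the (unique) entropy solution, which for this linear problem is given by $u^\alpha(\cdot,t)=\mathcal{F}^{-1}\big(e^{-t\,a\,|2\pi\cdot|^\alpha}\,\mathcal{F}u(\cdot,0)\big)$, with $\mathcal{F}\phi(\xi)=\int_{\mathbb{R}^d}e^{-2i\pi x\cdot\xi}\phi(x)\,dx$ (so $(-\triangle)^{\alpha/2}\phi=\mathcal{F}^{-1}(|2\pi\cdot|^\alpha\mathcal{F}\phi)$). $\|w\|_{C([0,T];L^1)}=\sup_{t\in[0,T]}\|w(\cdot,t)\|_{L^1(\mathbb{R}^d)}$. The quantity $\mathrm{Lip}_\alpha(u;\lambda)$ depends on $T$ and $a$ only through $M=Ta$, and on $\gamma$, $d$, $\lambda$; in (i) $\gamma$ is fixed as $M\downarrow0$ and in (ii) $M$ is fixed as $\gamma\to+\infty$. The limsup is over $\alpha\ne\beta$. *)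

(* Defs.v *)
From HB Require Import structures.
From mathcomp Require Import all_boot all_order all_algebra.
From mathcomp Require Import complex.
From mathcomp Require Import all_classical all_reals all_analysis.

Set Implicit Arguments.
Unset Strict Implicit.
Unset Printing Implicit Defensive.

Import Order.TTheory GRing.Theory Num.Theory.
Import numFieldNormedType.Exports.

Local Open Scope classical_set_scope.
Local Open Scope ring_scope.

Notation Rn R d := (d.-tuple (measurableTypeR R)).

Section LebesgueRn.
Variable R : realType.

Definition consRn n (p : measurableTypeR R * Rn R n) : Rn R n.+1 :=
  [the n.+1.-tuple (measurableTypeR R) of p.1 :: p.2].

Lemma measurable_consRn n : measurable_fun [set: _] (@consRn n).
Proof. exact: measurable_cons. Qed.

Lemma consRnK n : cancel (@consRn n) (fun x => (thead x, [tuple of behead x])).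
Proof.
by case=> a x; rewrite /consRn/= theadE; congr pair; apply: val_inj.
Qed.

Section pushforward_consRn.
Variables (n : nat) (mu : {sigma_finite_measure set (Rn R n) -> \bar R}).

Definition lebesgue_consRn : set (Rn R n.+1) -> \bar R :=
  pushforward ((@lebesgue_measure R) \x mu)%E (@consRn n).

Let lebesgue_consRn0 : lebesgue_consRn set0 = 0%E.
Proof. by rewrite /lebesgue_consRn /pushforward preimage_set0 measure0. Qed.

Let lebesgue_consRn_ge0 A : (0 <= lebesgue_consRn A)%E.
Proof. by rewrite /lebesgue_consRn /pushforward measure_ge0. Qed.

Let lebesgue_consRn_sigma_additive : semi_sigma_additive lebesgue_consRn.
Proof.
move=> F mF tF mUF; rewrite /lebesgue_consRn /pushforward preimage_bigcup.
apply: measure_semi_sigma_additive.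
- by move=> k; rewrite -[X in measurable X]setTI; exact: measurable_consRn.
- apply/trivIsetP => /= i j _ _ ij; rewrite -preimage_setI.
  by move/trivIsetP : tF => /(_ _ _ _ _ ij) ->//; rewrite preimage_set0.
- by rewrite -preimage_bigcup -[X in measurable X]setTI;
    exact: measurable_consRn.
Qed.

HB.instance Definition _ := isMeasure.Build _ _ _ lebesgue_consRn
  lebesgue_consRn0 lebesgue_consRn_ge0 lebesgue_consRn_sigma_additive.

Lemma lebesgue_consRnE A B : measurable A -> measurable B ->
  lebesgue_consRn [set x | A (thead x) /\ B [tuple of behead x]] =
  (lebesgue_measure A * mu B)%E.
Proof.
move=> mA mB; rewrite -product_measure1E//.
rewrite /lebesgue_consRn /pushforward; congr (product_measure1 _ _ _).
apply/seteqP; split=> p /=; have /(congr1 fst)/= -> := consRnK p;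
  by have /(congr1 snd)/= -> := consRnK p.
Qed.

Let lebesgue_consRn_sigma_finite : sigma_finite setT lebesgue_consRn.
Proof.
have /sigma_finiteP[F [TF ndF Foo]] := sigma_finiteT (@lebesgue_measure R).
have /sigma_finiteP[G [TG ndG Goo]] := sigma_finiteT mu.
exists (fun k => [set x | F k (thead x) /\ G k [tuple of behead x]]).
  apply/esym; rewrite -subTset => x _.
  have [k _ Fk] : (\bigcup_k F k) (thead x) by rewrite -TF.
  have [l _ Gl] : (\bigcup_k G k) [tuple of behead x] by rewrite -TG.
  exists (maxn k l) => //; split.
    by move: Fk; exact/subsetPset/ndF/leq_maxl.
  by move: Gl; exact/subsetPset/ndG/leq_maxr.
move=> k; have [mF Fk] := Foo k; have [mG Gk] := Goo k; split.
  apply: (@measurableI _ _ ((fun x => thead x) @^-1` F k)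
    ((fun x : Rn R n.+1 => [tuple of behead x]) @^-1` G k)).
    rewrite -[X in measurable X]setTI.
    exact: (@measurable_tnth _ (measurableTypeR R) n.+1 ord0).
  by rewrite -[X in measurable X]setTI; exact: measurable_behead.
by rewrite lebesgue_consRnE// lte_mul_pinfty// ge0_fin_numE.
Qed.

HB.instance Definition _ := Measure_isSigmaFinite.Build _ _ _ lebesgue_consRn
  lebesgue_consRn_sigma_finite.

End pushforward_consRn.

Fixpoint lebesgue_Rn d : {sigma_finite_measure set (Rn R d) -> \bar R} :=
  if d is n.+1 then lebesgue_consRn (lebesgue_Rn n)
  else \d_([tuple] : Rn R 0).


(* lebesgue_Rn gives boxes their usual volume; being sigma-finite, it is thus
   the Lebesgue measure of R^d. *)
Lemma lebesgue_Rn_box d (A : 'I_d -> set (measurableTypeR R)) :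
  (forall i, measurable (A i)) ->
  lebesgue_Rn d [set x | forall i, A i (tnth x i)] =
  (\prod_(i < d) lebesgue_measure (A i))%E.
Proof.
elim: d A => [|d IH] A mA.
  rewrite big_ord0 /= diracE mem_set// => -[]//.
rewrite big_ord_recl -IH => [|i]; last exact: mA.
rewrite -[RHS]lebesgue_consRnE//.
  congr lebesgue_consRn; apply/seteqP; split=> x /=; case/tupleP: x => a x.
    have -> : [tuple of behead [tuple of a :: x]] = x by exact: val_inj.
    move=> Ax; split=> [|i]; first exact: (Ax ord0).
    by have := Ax (lift ord0 i); rewrite tnthS.
  have -> : [tuple of behead [tuple of a :: x]] = x by exact: val_inj.
  move=> [A0 AS] i; case: (unliftP ord0 i) => [j ->|->]; last exact: A0.
  by have := AS j; rewrite tnthS.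
rewrite (_ : mkset _ = \bigcap_(i in [set: 'I_d])
  ((fun x : Rn R d => tnth x i) @^-1` A (lift ord0 i))); last first.
  by apply/seteqP; split=> x /= Ax i => [_|]; exact: Ax.
apply: fin_bigcap_measurable => // i _.
by rewrite -[X in measurable X]setTI; exact: measurable_tnth.
Qed.

End LebesgueRn.

Section Fourier.
Variables (R : realType) (d : nat).
Implicit Types (x xi : Rn R d) (f : Rn R d -> R[i]).
Local Open Scope complex_scope.

Definition dotp x xi : R := \sum_(i < d) tnth x i * tnth xi i.

Definition enorm x : R := Num.sqrt (dotp x x).

Definition expi (theta : R) : R[i] := cos theta +i* sin theta.

(* Meaningful for absolutely integrable f: Rintegral defaults to a junk value
   otherwise. *)
Definition cintegral f : R[i] :=
  (\int[lebesgue_Rn R d]_x complex.Re (f x))%R +i*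
  (\int[lebesgue_Rn R d]_x complex.Im (f x))%R.

Definition fourier f xi : R[i] :=
  cintegral (fun x => expi (- (2 * pi * dotp x xi)) * f x).

Definition inv_fourier f x : R[i] :=
  cintegral (fun xi => expi (2 * pi * dotp x xi) * f xi).

Definition L1norm f : \bar R :=
  (\int[lebesgue_Rn R d]_x (ComplexField.Normc.normc (f x))%:E)%E.

End Fourier.

Section FractionalHeat.
Variables (R : realType) (d : nat).
Local Open Scope complex_scope.

Definition cube : set (Rn R d) := [set x | forall i, -1 <= tnth x i <= 1].

Definition init (gamma : R) (x : Rn R d) : R[i] :=
  (gamma * \1_cube [tuple of map ( *%R gamma^-1) x])%:C.

(* u^alpha(x, t), kept complex-valued as given by the inverse Fourier transform
   (its imaginary part vanishes).
   At t = 0 the multiplier is 1 and the Fourier transform of the initial datum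
   is not absolutely integrable, so the inversion integral is only used for
   t > 0, where the multiplier makes it absolutely convergent. *)
Definition sol (a gamma alpha : R) (x : Rn R d) (t : R) : R[i] :=
  if t == 0 then init gamma x
  else inv_fourier (fun xi =>
    (expR (- (t * a * (2 * pi * enorm xi) `^ alpha)))%:C *
    fourier (init gamma) xi) x.

Definition CL1norm (T : R) (w : Rn R d -> R -> R[i]) : \bar R :=
  ereal_sup [set L1norm (w ^~ t) | t in `[0, T]].

Definition Lip (lambda T a gamma : R) : \bar R :=
  limf_esup (fun p : R * R =>
      CL1norm T (fun x t => (sol a gamma p.1 x t - sol a gamma p.2 x t)%R)
      / `|p.1 - p.2|%:E)%E
    (within [set p | p.1 != p.2] (nbhs (lambda, lambda))).

End FractionalHeat.

Definition sigmaM (R : realType) (lambda M : R) : R :=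
  if 1 < lambda then M `^ lambda^-1 * `|ln M|
  else if lambda == 1 then M * ln M ^+ 2
  else M.

Definition sigmag (R : realType) (d : nat) (lambda gamma : R) : R :=
  if 1 < lambda then gamma ^+ d
  else if lambda == 1 then gamma ^+ d * ln gamma ^+ 2
  else gamma `^ (d%:R + 1 - lambda) * ln gamma.

(* Main.v *)
(** The norm over [0, T] is bounded below by its value at [t = T], and the L^1
norm by a pairing with a trigonometric polynomial of sup norm at most 1 in the
single variable [x_1]. Fourier inversion turns that pairing into a finite
combination of the values
[(exp (- M s^alpha) - exp (- M s^beta)) * u0_hat s] at its frequencies [s];
dividing by [alpha - beta] and letting [alpha] tend to [beta = lambda] yields
the lower bound [| sum_j c_j u0_hat s_j M s_j^lambda (ln s_j) exp (- M s_j^lambda) |]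
for the Lipschitz constant. The frequencies are odd multiples of
[theta = pi / (2 gamma)], where [|u0_hat s| = 2 (2 gamma)^(d-1) gamma / s].

For [lambda <> 1] a single frequency suffices: [s ~ M^(-1/lambda)] or [s ~ 1]
if [lambda > 1], and [s = theta] if [lambda < 1]. For [lambda = 1] every
frequency between [1] and [1/M] (resp. [theta] and [1]) contributes equally on
a logarithmic scale, which is where the extra logarithm comes from; they are
tested simultaneously by the partial sums of the Fourier series of the square
wave, which are bounded uniformly in their length. *)

Require Import Defs.
From mathcomp Require Import all_boot all_order all_algebra.
From mathcomp Require Import complex ring lra zify.
From mathcomp Require Import all_classical all_reals all_analysis.
From mathcomp Require Import measurable_realfun.
Import Order.TTheory GRing.Theory Num.Theory.
Import numFieldNormedType.Exports.
Local Open Scope classical_set_scope.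
Local Open Scope ring_scope.

Set Implicit Arguments.
Unset Strict Implicit.
Unset Printing Implicit Defensive.

(** * Integrals over R^d *)

(** Two obstacles shape the proof. At positive times a solution is known only through its inversion
    integral: its integrability in space is never established, and the L^1 norm is treated as a
    possibly infinite quantity. Inversion is therefore applied to the product with a damped test
    function, and the damping is removed only in the final inequality. Testing the real part is
    enough: the transform of the even initial datum is real, so this real part is a cosine
    transform, and no complex integral survives. The second obstacle is cancellation between modes.
    The coefficients of the test polynomial must undo the sign of u0_hat at each frequency, and all
    logarithms involved must have the same sign. For [lambda = 1] this fixes the range of modes:
    only frequencies at least 1 are used in small time, only frequencies at most the square root of
    theta for large data. *)

Lemma integrable_measurable d (T : measurableType d) (R : realType)
  (m : {measure set T -> \bar R}) (f : T -> R) :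
  m.-integrable setT (EFin \o f) -> measurable_fun setT f.
Proof. by move=> If; exact/measurable_EFinP/(measurable_int _ If). Qed.

Section prodmeas.
Context d1 d2 (T1 : measurableType d1) (T2 : measurableType d2) (R : realType).
Variables (m1 : {sigma_finite_measure set T1 -> \bar R})
  (m2 : {sigma_finite_measure set T2 -> \bar R}).

Lemma integrable_prodM (f : T1 -> R) (g : T2 -> R) :
  m1.-integrable setT (EFin \o f) -> m2.-integrable setT (EFin \o g) ->
  (m1 \x m2)%E.-integrable setT (EFin \o (fun z => f z.1 * g z.2)).
Proof.
move=> If Ig; have mf : measurable_fun setT f := integrable_measurable If.
have mg : measurable_fun setT g := integrable_measurable Ig.
apply/integrable12ltyP.
  apply/measurable_EFinP; apply: measurable_funM.
    exact: measurableT_comp measurable_fst.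
  exact: measurableT_comp measurable_snd.
rewrite /=; under eq_integral => x _.
  under eq_integral => y _ do rewrite normrM EFinM.
  rewrite ge0_integralZl//; last exact/measurable_EFinP/measurableT_comp.
  over.
have [_ fy] := integrableP _ _ _ If; have [_ gy] := integrableP _ _ _ Ig.
rewrite ge0_integralZr//; last 2 first.
- exact/measurable_EFinP/measurableT_comp.
- exact: integral_ge0.
by apply: lte_mul_pinfty => //; [exact: integral_ge0|rewrite ge0_fin_numE//; exact: integral_ge0].
Qed.

Lemma Rintegral_prodM (f : T1 -> R) (g : T2 -> R) :
  m1.-integrable setT (EFin \o f) -> m2.-integrable setT (EFin \o g) ->
  (\int[(m1 \x m2)%E]_z (f z.1 * g z.2) = (\int[m1]_x f x) * \int[m2]_y g y).
Proof.
move=> If Ig; rewrite /Rintegral -integral12_prod_meas1; last exact: integrable_prodM.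
rewrite /fubini_F/=; under eq_integral => x _.
  under eq_integral => y _ do rewrite EFinM.
  rewrite integralZl//.
  rewrite -(fineK (integrable_fin_num measurableT Ig)).
  over.
rewrite integralZr//= fineM//; exact: integrable_fin_num.
Qed.
End prodmeas.
Section Rn_integral.
Variable R : realType.
Local Notation mu := (@lebesgue_measure R).
Local Notation mud d := (lebesgue_Rn R d).

(** By definition, [lebesgue_Rn] in dimension [n.+1] is a pushforward under [consRn]; this reduces
    integrals over R^n to products, by induction on the dimension. *)
Lemma lebesgue_Rn_int n (f : Rn R n.+1 -> R) : measurable_fun setT f ->
  (mu \x mud n)%E.-integrable setT (EFin \o (f \o @consRn R n)) ->
  (mud n.+1).-integrable setT (EFin \o f) /\
  \int[mud n.+1]_x f x = \int[(mu \x mud n)%E]_z f (consRn z).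
Proof.
move=> mf If; have mEf : measurable_fun setT (EFin \o f) by exact/measurable_EFinP.
split.
  exact: (integrable_pushforward (@measurable_consRn R n) mEf If).
rewrite /Rintegral; congr fine.
exact: (integral_pushforward (@measurable_consRn R n) mEf If).
Qed.

Lemma tnth_consRn0 n (z : measurableTypeR R * Rn R n) : tnth (consRn z) ord0 = z.1.
Proof. by []. Qed.

Lemma tnth_consRnS n (z : measurableTypeR R * Rn R n) i :
  tnth (consRn z) (lift ord0 i) = tnth z.2 i.
Proof. by rewrite /consRn /= tnthS. Qed.

Lemma measurable_prodRn n (h : 'I_n -> R -> R) : (forall i, measurable_fun setT (h i)) ->
  measurable_fun setT (fun x : Rn R n => \prod_i h i (tnth x i)).
Proof.
move=> mh; apply: measurable_prod => i _.
apply: measurableT_comp (mh i) _; exact: measurable_tnth.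
Qed.

Lemma Rintegral_prodRn n (h : 'I_n -> R -> R) :
  (forall i, mu.-integrable setT (EFin \o h i)) ->
  (mud n).-integrable setT (EFin \o (fun x => \prod_i h i (tnth x i))) /\
  \int[mud n]_x \prod_i h i (tnth x i) = \prod_i \int[mu]_x h i x.
Proof.
elim: n h => [|n IH] h Ih.
  rewrite big_ord0; under eq_Rintegral do rewrite big_ord0.
  split.
    have J : (mud 0).-integrable setT (EFin \o cst 1).
      exact: (@finite_measure_integrable_cst _ _ R (\d_([tuple] : Rn R 0))).
    by apply: eq_integrable J => // x _ /=; rewrite big_ord0.
  (* In dimension 0 the measure is the Dirac mass at the empty tuple, of total mass 1. *)
  rewrite Rintegral_cst//.
  rewrite mul1r.
  exact: (congr1 fine (diracT R ([tuple] : Rn R 0))).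
have [I2 E2] := IH (fun i => h (lift ord0 i)) (fun i => Ih _).
have E x : (fun x => \prod_(i < n.+1) h i (tnth x i)) (consRn x) = h ord0 x.1 *
  \prod_i h (lift ord0 i) (tnth x.2 i).
  by rewrite /= big_ord_recl tnth_consRn0; congr (_ * _); apply: eq_bigr => i _;
    rewrite tnth_consRnS.
have [] := @lebesgue_Rn_int n (fun x => \prod_(i < n.+1) h i (tnth x i)).
- by apply: measurable_prodRn => i; exact: integrable_measurable (Ih i).
- apply: eq_integrable (integrable_prodM (Ih ord0) I2) => //.
  by move=> x _; rewrite /= -E.
move=> J ->; split=> //.
under eq_Rintegral do rewrite E.
by rewrite big_ord_recl -E2; exact: Rintegral_prodM (Ih ord0) I2.
Qed.
End Rn_integral.

Section Rn_char.
Variable R : realType.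
Local Notation mu := (@lebesgue_measure R).
Local Notation mud d := (lebesgue_Rn R d).

Lemma integrableM_le1 d (T : measurableType d) (m : {measure set T -> \bar R}) (f g : T -> R) :
  m.-integrable setT (EFin \o f) -> measurable_fun setT g -> (forall x, `|g x| <= 1) ->
  m.-integrable setT (EFin \o (fun x => f x * g x)).
Proof.
move=> If mg g1; have mf := integrable_measurable If.
apply: le_integrable If => //; first exact/measurable_EFinP/measurable_funM.
by move=> x _ /=; rewrite lee_fin normrM ler_piMr.
Qed.

Lemma measurable_cosR : measurable_fun setT (@cos R).
Proof. by apply: continuous_measurable_fun; exact: continuous_cos. Qed.

Lemma measurable_sinR : measurable_fun setT (@sin R).
Proof. by apply: continuous_measurable_fun; exact: continuous_sin. Qed.

Lemma normr_cos_le1 (x : R) : `|cos x| <= 1.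
Proof. by rewrite ler_norml cos_geN1 cos_le1. Qed.

Lemma normr_sin_le1 (x : R) : `|sin x| <= 1.
Proof. by rewrite ler_norml sin_geN1 sin_le1. Qed.

Lemma measurable_linear_form n (s : 'I_n -> R) :
  measurable_fun setT (fun x : Rn R n => \sum_i tnth x i * s i).
Proof.
apply: measurable_sum => i; apply: measurable_funM => //; exact: measurable_tnth.
Qed.

Lemma integrableM_cos (h : R -> R) (s : R) : mu.-integrable setT (EFin \o h) ->
  mu.-integrable setT (EFin \o (fun x => h x * cos (x * s))).
Proof.
move=> Ih; apply: integrableM_le1 => //; last by move=> x; exact: normr_cos_le1.
by apply: measurableT_comp measurable_cosR _; exact: measurable_funM.
Qed.

Lemma integrableM_sin (h : R -> R) (s : R) : mu.-integrable setT (EFin \o h) ->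
  mu.-integrable setT (EFin \o (fun x => h x * sin (x * s))).
Proof.
move=> Ih; apply: integrableM_le1 => //; last by move=> x; exact: normr_sin_le1.
by apply: measurableT_comp measurable_sinR _; exact: measurable_funM.
Qed.

Lemma integrableM_cosRn n (f : Rn R n -> R) (s : 'I_n -> R) :
  (mud n).-integrable setT (EFin \o f) ->
  (mud n).-integrable setT (EFin \o (fun x => f x * cos (\sum_i tnth x i * s i))).
Proof.
move=> If; apply: integrableM_le1 => //; last by move=> x; exact: normr_cos_le1.
by apply: measurableT_comp measurable_cosR _; exact: measurable_linear_form.
Qed.

Lemma integrableM_sinRn n (f : Rn R n -> R) (s : 'I_n -> R) :
  (mud n).-integrable setT (EFin \o f) ->
  (mud n).-integrable setT (EFin \o (fun x => f x * sin (\sum_i tnth x i * s i))).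
Proof.
move=> If; apply: integrableM_le1 => //; last by move=> x; exact: normr_sin_le1.
by apply: measurableT_comp measurable_sinR _; exact: measurable_linear_form.
Qed.

(** Cosine and sine are treated together because the addition formulas mix them. Each factor has a
    vanishing sine integral, so only the product of cosines survives. *)
Lemma Rintegral_prodRn_char n (h : 'I_n -> R -> R) (s : 'I_n -> R) :
  (forall i, mu.-integrable setT (EFin \o h i)) ->
  (forall i, \int[mu]_x (h i x * sin (x * s i)) = 0) ->
  \int[mud n]_x ((\prod_i h i (tnth x i)) * cos (\sum_i tnth x i * s i)) =
    \prod_i \int[mu]_x (h i x * cos (x * s i)) /\
  \int[mud n]_x ((\prod_i h i (tnth x i)) * sin (\sum_i tnth x i * s i)) = 0.
Proof.
elim: n h s => [|n IH] h s Ih Sh.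
  rewrite big_ord0; under eq_Rintegral do rewrite !big_ord0 cos0 mulr1.
  under [X in _ /\ X = _]eq_Rintegral do rewrite !big_ord0 sin0 mulr0.
  have [_] := @Rintegral_prodRn R 0 h Ih.
  under eq_Rintegral do rewrite big_ord0.
  by rewrite big_ord0 => ->; rewrite /Rintegral integral0.
have [I1 _] := Rintegral_prodRn Ih.
have Ih' i : mu.-integrable setT (EFin \o h (lift ord0 i)) by [].
have [I2 _] := Rintegral_prodRn Ih'.
have [C2 S2] := IH _ _ Ih' (fun i => Sh (lift ord0 i)).
pose H (x : Rn R n) := \prod_i h (lift ord0 i) (tnth x i).
pose d (x : Rn R n) := \sum_i tnth x i * s (lift ord0 i).
have E z : \prod_i h i (tnth (consRn z) i) = h ord0 z.1 * H z.2.
  by rewrite /= big_ord_recl tnth_consRn0; congr (_ * _); apply: eq_bigr => i _;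
    rewrite tnth_consRnS.
have D z : \sum_i tnth (consRn z) i * s i = z.1 * s ord0 + d z.2.
  by rewrite /= big_ord_recl tnth_consRn0; congr (_ + _); apply: eq_bigr => i _;
    rewrite tnth_consRnS.
have Icc := integrable_prodM (integrableM_cos (s ord0) (Ih ord0)) (integrableM_cosRn (fun i =>
  s (lift ord0 i)) I2).
have Iss := integrable_prodM (integrableM_sin (s ord0) (Ih ord0)) (integrableM_sinRn (fun i =>
  s (lift ord0 i)) I2).
have Isc := integrable_prodM (integrableM_sin (s ord0) (Ih ord0)) (integrableM_cosRn (fun i =>
  s (lift ord0 i)) I2).
have Ics := integrable_prodM (integrableM_cos (s ord0) (Ih ord0)) (integrableM_sinRn (fun i =>
  s (lift ord0 i)) I2).
have Rcc := Rintegral_prodM (integrableM_cos (s ord0) (Ih ord0)) (integrableM_cosRn (fun i =>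
  s (lift ord0 i)) I2).
have Rss := Rintegral_prodM (integrableM_sin (s ord0) (Ih ord0)) (integrableM_sinRn (fun i =>
  s (lift ord0 i)) I2).
have Rsc := Rintegral_prodM (integrableM_sin (s ord0) (Ih ord0)) (integrableM_cosRn (fun i =>
  s (lift ord0 i)) I2).
have Rcs := Rintegral_prodM (integrableM_cos (s ord0) (Ih ord0)) (integrableM_sinRn (fun i =>
  s (lift ord0 i)) I2).
split.
- have [] := @lebesgue_Rn_int R n (fun x => (\prod_i h i (tnth x i)) * cos (\sum_i tnth x i *
  s i)).
  + exact: integrable_measurable (integrableM_cosRn s I1).
  + apply: eq_integrable (integrableB _ Icc Iss) => // z _.
    by rewrite /comp/= E D cosD -EFinB /H /d; congr EFin; ring.
  move=> _ ->.
  transitivity (\int[(mu \x mud n)%E]_z ((h ord0 z.1 * cos (z.1 * s ord0)) * (H z.2 *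
    cos (d z.2)) -
     (h ord0 z.1 * sin (z.1 * s ord0)) * (H z.2 * sin (d z.2)))).
    by apply: eq_Rintegral => z _; rewrite E D cosD; ring.
  rewrite [LHS](RintegralB measurableT Icc Iss).
  by rewrite Rcc Rss Sh C2 mul0r subr0 big_ord_recl.
- have [] := @lebesgue_Rn_int R n (fun x => (\prod_i h i (tnth x i)) * sin (\sum_i tnth x i *
  s i)).
  + exact: integrable_measurable (integrableM_sinRn s I1).
  + apply: eq_integrable (integrableD _ Isc Ics) => // z _.
    by rewrite /comp/= E D sinD -EFinD /H /d; congr EFin; ring.
  move=> _ ->.
  transitivity (\int[(mu \x mud n)%E]_z ((h ord0 z.1 * sin (z.1 * s ord0)) * (H z.2 *
    cos (d z.2)) +
     (h ord0 z.1 * cos (z.1 * s ord0)) * (H z.2 * sin (d z.2)))).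
    by apply: eq_Rintegral => z _; rewrite E D sinD; ring.
  rewrite [LHS](RintegralD measurableT Isc Ics).
  by rewrite Rsc Rcs Sh S2 mul0r mulr0 addr0.
Qed.
End Rn_char.

(** * Folding and affine substitution on the line *)

Section OneDim.
Variable R : realType.
Local Notation mu := (@lebesgue_measure R).

(** Moves the integral to the half-line, where it can be computed from a primitive with a limit at
    infinity. *)
Lemma ge0_integral_fold (f : R -> R) : (forall x, 0 <= f x) -> continuous f ->
  (\int[mu]_x (f x)%:E = \int[mu]_(x in `[0%R, +oo[) (f x + f (- x))%:E)%E.
Proof.
move=> f0 cf.
have mf : measurable_fun [set: R] f by exact: continuous_measurable_fun.
have mpos : measurable [set` `[0%R, +oo[ : interval R] by [].
rewrite -(setUv [set` `[0%R, +oo[]) ge0_integral_setU//=; last 4 first.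
- exact: measurableC.
- by apply/measurable_EFinP; rewrite setUv.
- by move=> x _; rewrite lee_fin.
- exact/disj_setPCl.
rewrite setCitvr integral_itv_bndo_bndc; last exact/measurable_EFinP/measurable_funTS.
rewrite -{2}oppr0 ge0_integration_by_substitutionNy//; last exact: continuous_subspaceT.
under [RHS]eq_integral do rewrite EFinD.
rewrite ge0_integralD//.
- by move=> x _; rewrite lee_fin.
- exact/measurable_EFinP/measurable_funTS.
- by move=> x _; rewrite lee_fin.
- apply/measurable_EFinP/measurable_funTS; exact: measurableT_comp.
Qed.

Lemma ge0_integral_affine (G : R -> R) (a b : R) : 0 < a -> continuous G ->
  (forall x, 0 <= G x) ->
  (\int[mu]_x (G x)%:E = \int[mu]_x (G (a * x + b) * a)%:E)%E.
Proof.
move=> a0 cG G0.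
have dF (x : R) : is_derive x 1 (fun x : R => a * x + b) a.
  apply: is_derive_eq.
  by rewrite /GRing.scale/= mulr1 addr0.
have E : (fun x : R => a * x + b)^`()%classic = cst a.
  by apply/funext => x; rewrite derive1E; apply: derive_val.
rewrite (@increasing_ge0_integration_by_substitutionT _ (fun x => a * x + b))//.
- by rewrite E.
- by move=> x y xy; rewrite ltrD2r ltr_pM2l.
- by rewrite E; exact: cst_continuous.
- by rewrite E; exact: is_cvg_cst.
- by rewrite E; exact: is_cvg_cst.
- apply/cvgrNyPle => M; near=> x.
  have : x <= (M - b) / a by near: x; apply: nbhs_ninfty_le; exact: num_real.
  by rewrite ler_pdivlMr// mulrC lerBrDr.
- apply/cvgryPge => M; near=> x.
  have : (M - b) / a <= x by near: x; apply: nbhs_pinfty_ge; exact: num_real.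
  by rewrite ler_pdivrMr// mulrC lerBlDr.
Unshelve. all: by end_near. Qed.
End OneDim.

(** * The Poisson kernel and the box function *)

Section Poisson.
Variable R : realType.
Local Notation mu := (@lebesgue_measure R).

Lemma ge0_integrable_fin d (T : measurableType d) (m : {measure set T -> \bar R}) (f : T ->
  R) (r : R) :
  measurable_fun setT f -> (forall x, 0 <= f x) -> (\int[m]_x (f x)%:E = r%:E)%E ->
  m.-integrable setT (EFin \o f) /\ \int[m]_x f x = r.
Proof.
move=> mf f0 fr; split; last by rewrite /Rintegral fr.
apply/integrableP; split; first exact/measurable_EFinP.
under eq_integral do rewrite /= ger0_norm//.
by rewrite fr ltry.
Qed.

(** The Fourier transform of [expabs e] at the angular frequency s. As a function of [s / (2 * pi)]
    it is an approximate identity when e tends to 0. *)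
Definition poisson (e s : R) : R := 2 * e / (e ^+ 2 + s ^+ 2).

Lemma poisson_ge0 (e s : R) : 0 < e -> 0 <= poisson e s.
Proof.
by move=> e0; apply: divr_ge0; [rewrite mulr_ge0// ltW|rewrite addr_ge0 ?sqr_ge0].
Qed.

Lemma Rintegral_poisson (e w : R) : 0 < e ->
  mu.-integrable setT (EFin \o (fun y => poisson e (2 * pi * y - w))) /\
  \int[mu]_y poisson e (2 * pi * y - w) = 1.
Proof.
move=> e0; have pi0 := @pi_gt0 R.
have a0 : 0 < 2 * pi / e by rewrite !mulr_gt0// invr_gt0.
have c1 : continuous (fun x : R => (oneDsqr x)^-1) := continuous_oneDsqrV.
have p1 (x : R) : 0 <= (oneDsqr x)^-1.
  by rewrite invr_ge0 ltW// (lt_le_trans ltr01 (oneDsqr_ge1 x)).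
have E0 : (\int[mu]_x ((oneDsqr x)^-1)%:E = pi%:E)%E.
  rewrite ge0_symfun_integralT//; last by move=> x /=; rewrite /oneDsqr sqrrN.
  rewrite (_ : [set x | _] = `[0, +oo[%classic); last first.
    by apply/seteqP; split => x/=; rewrite in_itv/= andbT.
  by rewrite integral0y_oneDsqr -EFinM mulrCA divff// mulr1.
have E1 (y : R) : poisson e (2 * pi * y - w) =
    pi^-1 * ((oneDsqr (2 * pi / e * y + - w / e))^-1 * (2 * pi / e)).
  have -> : oneDsqr (2 * pi / e * y + - w / e) = (e ^+ 2 + (2 * pi * y - w) ^+ 2) / e ^+ 2.
    by rewrite /oneDsqr; field; rewrite gt_eqF.
  rewrite /poisson; move: (@pi R) pi0 => P P0; field; rewrite !gt_eqF//=.
  by rewrite ltr_wpDr ?sqr_ge0// exprn_gt0.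
have cl : continuous (fun x : R => 2 * pi / e * x + - w / e).
  by move=> x; apply: cvgD; [apply: cvgMl_tmp; exact: cvg_id|exact: cvg_cst].
have mf : measurable_fun setT (fun y => ((oneDsqr (2 * pi / e * y + - w / e))^-1 * (2 * pi / e))).
  apply: measurable_funM => //; apply: continuous_measurable_fun => x.
  by apply: (@continuous_comp _ _ _ (fun x : R => 2 * pi / e * x + - w / e) (fun x :
    R => (oneDsqr x)^-1)); [exact: cl|exact: c1].
under eq_Rintegral do rewrite E1.
have [I J] : mu.-integrable setT (EFin \o (fun y => pi^-1 * ((oneDsqr (2 * pi / e * y +
  - w / e))^-1 * (2 * pi / e)))) /\
   \int[mu]_y (pi^-1 * ((oneDsqr (2 * pi / e * y + - w / e))^-1 * (2 * pi / e))) = 1.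
  apply: ge0_integrable_fin.
  - by apply: measurable_funM.
  - by move=> x; rewrite !mulr_ge0 ?invr_ge0// ltW.
  under eq_integral do rewrite EFinM.
  rewrite ge0_integralZl//; last 3 first.
  - exact/measurable_EFinP.
  - by move=> x _; rewrite lee_fin !mulr_ge0 ?invr_ge0// ltW.
  - by rewrite lee_fin invr_ge0 ltW.
  by rewrite -(ge0_integral_affine _ a0 c1 p1) E0 -EFinM mulVf// gt_eqF.
split=> //; apply: eq_integrable I => // y _.
by rewrite /= E1.
Qed.

Lemma poisson_tail w (x d : R) : 2 * pi * x = w -> 0 < d ->
  exists2 C : R, 0 <= C & forall e : R, 0 < e ->
    mu.-integrable setT (EFin \o (fun y => (d <= `|y - x|)%R%:R * poisson e (2 * pi * y - w))) /\
    \int[mu]_y ((d <= `|y - x|)%R%:R * poisson e (2 * pi * y - w)) <= C * e.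
Proof.
move=> xw d0; have pi0 := @pi_gt0 R.
(* With D = 2 pi d and |s| >= D, 1 / s^2 <= (1 + 1 / D^2) / (1 + s^2): the tail is at most [C * e]
   times the kernel of width 1, whose mass is 1. *)
exists (1 + (2 * pi * d) ^- 2); first by rewrite addr_ge0// invr_ge0 sqr_ge0.
move=> e e0; have [I J] := Rintegral_poisson w e0.
have [I1 J1] := Rintegral_poisson w (@ltr01 R).
have mp : measurable_fun setT (fun y : R => (d <= `|y - x|)%R%:R : R).
  have -> : (fun y : R => (d <= `|y - x|)%R%:R : R) = \1_[set y | d <= `|y - x|].
    by apply/funext => y; rewrite indicE; congr ((_ : bool)%:R);
      apply/idP/idP => [h|/set_mem//]; apply/mem_set.
  apply: measurable_indic.
  have mg : measurable_fun setT (fun y : R => `|y - x|).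
    by apply: measurableT_comp => //; exact: measurable_funB.
  rewrite (_ : [set y | _] = setT `&` (fun y : R => `|y - x|) @^-1` [set` `[d, +oo[]); last first.
    by apply/seteqP; split => y /=; rewrite in_itv/= andbT => // -[].
  exact: mg.
have I2 : mu.-integrable setT (EFin \o (fun y => (d <= `|y - x|)%R%:R * poisson e (2 * pi *
  y - w))).
  under eq_fun do rewrite mulrC.
  apply: integrableM_le1 => // y; rewrite normr_nat.
  by rewrite -[leRHS]/(1%:R) ler_nat leq_b1.
split=> //.
set c := _ * e.
have -> : c = \int[mu]_y (c * poisson 1 (2 * pi * y - w)) by rewrite RintegralZl// J1 mulr1.
apply: le_Rintegral => //; first by apply: eq_integrable (integrableZl _ c I1) => // y _;
  rewrite /= EFinM.
rewrite {}/c.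
move=> y _; case: (boolP (d <= `|y - x|)) => dy; last first.
  rewrite mul0r; apply: mulr_ge0; last exact: poisson_ge0.
  by apply: mulr_ge0; [rewrite addr_ge0// invr_ge0 sqr_ge0|exact: ltW].
rewrite mul1r /poisson -xw -mulrBr.
set s := 2 * pi * (y - x).
have s0 : 2 * pi * d <= `|s| by rewrite normrM (ger0_norm (ltW _)) ?mulr_gt0// ler_pM2l//
  mulr_gt0.
have d20 : 0 < 2 * pi * d by rewrite !mulr_gt0.
have ss : (2 * pi * d) ^+ 2 <= s ^+ 2.
  by rewrite -[s ^+ 2]real_normK ?num_real// ler_sqr ?nnegrE// ltW.
have d2 : 0 < (2 * pi * d) ^+ 2 by rewrite exprn_gt0.
have s2 : 0 < s ^+ 2 by exact: lt_le_trans ss.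
rewrite expr1n mulr1.
apply: (@le_trans _ _ (2 * e / s ^+ 2)).
  have es : 0 < e ^+ 2 + s ^+ 2 by rewrite addr_gt0// exprn_gt0.
  apply: ler_wpM2l; first by rewrite mulr_ge0// ltW.
  by rewrite lef_pV2 ?posrE// lerDr sqr_ge0.
have -> : (1 + (2 * pi * d) ^- 2) * e * (2 / (1 + s ^+ 2)) =
   2 * e * ((1 + (2 * pi * d) ^- 2) / (1 + s ^+ 2)) by ring.
apply: ler_wpM2l; first by rewrite mulr_ge0// ltW.
rewrite ler_pdivlMr; last by rewrite addr_gt0.
rewrite mulrDr mulr1 mulVf ?gt_eqF// addrC lerD2l.
by rewrite lef_pV2 ?posrE.
Qed.
End Poisson.

Section ExpAbs.
Variable R : realType.
Local Notation mu := (@lebesgue_measure R).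
Implicit Types e s b x : R.

Lemma cvgy_expRN e : 0 < e -> expR (- (e * x)) @[x --> +oo] --> (0 : R).
Proof.
move=> e0; apply: (@cvg_comp _ _ _ (fun x => e * x) (fun y => expR (- y))); last exact: cvgr_expR.
apply/cvgryPge => M; near=> x.
have : M / e <= x by near: x; apply: nbhs_pinfty_ge; exact: num_real.
by rewrite ler_pdivrMr// mulrC.
Unshelve. all: by end_near. Qed.

Lemma continuous_cos_linear (s : R) : continuous (fun x : R => cos (x * s)).
Proof.
move=> x; apply: (@continuous_comp _ _ _ (fun x : R => x * s) (@cos R));
  last exact: continuous_cos.
exact: mulrr_continuous.
Qed.

Lemma continuous_sin_linear (s : R) : continuous (fun x : R => sin (x * s)).
Proof.
move=> x; apply: (@continuous_comp _ _ _ (fun x : R => x * s) (@sin R));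
  last exact: continuous_sin.
exact: mulrr_continuous.
Qed.

(** The constant 1 keeps the integrand nonnegative, as the fundamental theorem of calculus on an
    unbounded interval requires; the cosine integral is recovered later by subtraction. The
    parameter b is 1 for the cosine and 0 for functions with vanishing even part. *)
Lemma integral0y_expR_cos e s b : 0 < e -> `|b| <= 1 ->
  (\int[mu]_(x in `[0%R, +oo[) (2 * (expR (- (e * x)) * (1 + b * cos (x * s))))%:E =
   (2 / e + b * poisson e s)%:E)%E.
Proof.
move=> e0 b1; have es : 0 < e ^+ 2 + s ^+ 2 by rewrite ltr_wpDr ?sqr_ge0// exprn_gt0.
pose B x := 2 * (- e^-1 + b * (s * sin (x * s) - e * cos (x * s)) / (e ^+ 2 + s ^+ 2)).
pose F x := expR (- (e * x)) * B x.
have dF (x : R) : is_derive x 1 F (2 * (expR (- (e * x)) * (1 + b * cos (x * s)))).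
  rewrite /F /B; apply: is_derive_eq.
  rewrite /GRing.scale/=.
  by field; rewrite !gt_eqF.
have cF : continuous F.
  move=> x; apply: differentiable_continuous; apply/derivable1_diffP.
  by have [] := dF x.
have -> : (2 / e + b * poisson e s)%:E = (0%:E - (F 0)%:E)%E.
  rewrite /F /B -EFinB mulr0 oppr0 expR0 !mul0r sin0 cos0 /poisson; congr EFin.
  by field; rewrite !gt_eqF.
apply: ge0_continuous_FTC2y.
- move=> x _; rewrite !mulr_ge0 ?expR_ge0//.
  have : `|b * cos (x * s)| <= 1 by rewrite normrM mulr_ile1 ?normr_cos_le1.
  by rewrite ler_norml => /andP[]; lra.
- apply: continuous_subspaceT => x.
  apply: cvgM; first exact: cvg_cst.
  apply: cvgM.
    apply: (@continuous_comp _ _ _ (fun x : R => - (e * x)) (@expR R));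
      last exact: continuous_expR.
    apply: cvgN; exact: mulrl_continuous.
  apply: cvgD; first exact: cvg_cst.
  apply: cvgM; first exact: cvg_cst.
  exact: continuous_cos_linear.
(* The primitive tends to 0 at infinity: [B] is bounded by [C] and the exponential decays. *)
- pose C := 2 * (e^-1 + (`|s| + e) / (e ^+ 2 + s ^+ 2)).
  have BC x : `|B x| <= C.
    rewrite /B normrM ger0_norm// ler_wpM2l//.
    apply: le_trans (ler_normD _ _) _; rewrite normrN normfV (gtr0_norm e0) lerD2l.
    rewrite normrM normfV (gtr0_norm es) ler_wpM2r ?invr_ge0 ?(ltW es)//.
    rewrite normrM -[leRHS]mul1r ler_pM//.
    apply: le_trans (ler_normB _ _) _; rewrite !normrM (ger0_norm (ltW e0)).
    by apply: lerD; apply: ler_piMr; rewrite ?normr_cos_le1 ?normr_sin_le1// ltW.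
  apply: (@squeeze_cvgr _ _ _ _ (fun x => - C * expR (- (e * x)))
    (fun x => C * expR (- (e * x)))).
  + near=> x; rewrite mulNr -ler_norml normrM (ger0_norm (expR_ge0 _)) mulrC.
    by rewrite ler_wpM2r ?expR_ge0.
  + rewrite -[X in _ --> X](mulr0 (- C)); apply: cvgMl_tmp; exact: cvgy_expRN.
  + rewrite -[X in _ --> X](mulr0 C); apply: cvgMl_tmp; exact: cvgy_expRN.
- by move=> x _; have [] := dF x.
- exact: cvg_at_right_filter (cF 0).
- by move=> x _; rewrite derive1E; apply: derive_val.
Unshelve. all: by end_near. Qed.

Definition expabs e x := expR (- (e * `|x|)).

Lemma continuous_expabs e : continuous (expabs e).
Proof.
move=> x; apply: (@continuous_comp _ _ _ (fun x : R => - (e * `|x|)) (@expR R));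
  last exact: continuous_expR.
apply: cvgN; apply: cvgMl_tmp; exact: norm_continuous.
Qed.

Lemma Rintegral_expabs_char e s : 0 < e ->
  [/\ mu.-integrable setT (EFin \o expabs e),
    \int[mu]_x (expabs e x * cos (x * s)) = poisson e s &
    \int[mu]_x (expabs e x * sin (x * s)) = 0].
Proof.
move=> e0.
(* [1 + f] is nonnegative, and folding keeps only the even part of f. This is applied to 0, the
   cosine and the sine. *)
have key (f : R -> R) b r : `|b| <= 1 -> continuous f -> (forall x, `|f x| <= 1) ->
   (forall x, f x + f (- x) = 2 * (b * cos (x * r))) ->
   mu.-integrable setT (EFin \o (fun x => expabs e x * (1 + f x))) /\
   \int[mu]_x (expabs e x * (1 + f x)) = 2 / e + b * poisson e r.
  move=> b1 cf f1 ff.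
  have cg : continuous (fun x => expabs e x * (1 + f x)).
    move=> x; apply: cvgM; first exact: continuous_expabs.
    by apply: cvgD; [exact: cvg_cst|exact: cf].
  have g0 x : 0 <= expabs e x * (1 + f x).
    rewrite mulr_ge0 ?expR_ge0//.
    by have := f1 x; rewrite ler_norml => /andP[]; lra.
  apply: ge0_integrable_fin => //; first exact: continuous_measurable_fun.
  rewrite ge0_integral_fold// -integral0y_expR_cos//.
  apply: eq_integral => x; rewrite inE/= in_itv/= andbT => x0; congr EFin.
  rewrite /expabs normrN ger0_norm// -mulrDr addrACA ff; ring.
have [I0 J0] := key (cst 0) 0 0 ltac:(by rewrite normr0) (@cst_continuous _ _ 0)
  (fun x => ltac:(by rewrite normr0)) (fun x => ltac:(by rewrite /= mul0r mulr0 addr0)).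
have [I1 J1] := key (fun x => cos (x * s)) 1 s ltac:(by rewrite normr1) (@continuous_cos_linear s)
  (fun x => normr_cos_le1 _) (fun x => ltac:(by rewrite /= mulNr cosN; ring)).
have [I2 J2] := key (fun x => sin (x * s)) 0 0 ltac:(by rewrite normr0) (@continuous_sin_linear s)
  (fun x => normr_sin_le1 _) (fun x => ltac:(by rewrite /= mulNr sinN; ring)).
have I : mu.-integrable setT (EFin \o expabs e).
  by apply: eq_integrable I0 => // x _ /=; rewrite addr0 mulr1.
have J : \int[mu]_x expabs e x = 2 / e.
  by rewrite -[RHS]addr0 -[X in _ + X](mul0r (poisson e 0)) -J0; apply: eq_Rintegral => x _;
    rewrite /= addr0 mulr1.
have E f (If : mu.-integrable setT (EFin \o (fun x => expabs e x * (1 + f x)))) :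
    \int[mu]_x (expabs e x * f x) = \int[mu]_x (expabs e x * (1 + f x)) - 2 / e.
  by rewrite -J -RintegralB//; apply: eq_Rintegral => x _; ring.
split=> //; first by rewrite (E (fun x => cos (x * s)))// J1; ring.
by rewrite (E (fun x => sin (x * s)))// J2; ring.
Qed.
End ExpAbs.

Section Box.
Variable R : realType.
Local Notation mu := (@lebesgue_measure R).
Implicit Types g s x : R.

Definition box g x : R := \1_[set` `[- g, g]] x.

Definition box_hat g s : R := \int[mu]_x (box g x * cos (x * s)).

Lemma integrable_box g : mu.-integrable setT (EFin \o box g).
Proof. exact: integrable_indic_itv. Qed.

Lemma Rintegral_boxM g (f : R -> R) :
  \int[mu]_x (box g x * f x) = \int[mu]_(x in `[- g, g]) f x.
Proof.
rewrite [RHS]Rintegral_mkcond; apply: eq_Rintegral => x _.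
by rewrite /box indicE patchE; case: ifP; rewrite ?mul1r ?mul0r.
Qed.

Lemma Rintegral_itv_FTC (f F : R -> R) (a b : R) : a < b -> continuous f ->
  (forall x : R, is_derive x 1 F (f x)) -> \int[mu]_(x in `[a, b]) f x = F b - F a.
Proof.
move=> ab cf dF.
have cF : continuous F.
  by move=> x; apply: differentiable_continuous; apply/derivable1_diffP; have [] := dF x.
rewrite /Rintegral (@continuous_FTC2 _ f F)//.
- exact: continuous_subspaceT.
- split.
  + by move=> x _; have [] := dF x.
  + exact: cvg_at_right_filter (cF a).
  + exact: cvg_at_left_filter (cF b).
- by move=> x _; rewrite derive1E; apply: derive_val.
Qed.

Lemma Rintegral_box g : 0 < g -> \int[mu]_x box g x = 2 * g.
Proof.
move=> g0; have := Rintegral_boxM g (cst 1); under eq_Rintegral do rewrite /= mulr1.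
have dF (x : R) : is_derive x 1 id (cst 1 x) by exact: is_derive_id.
move=> ->; rewrite (Rintegral_itv_FTC _ _ dF) ?gtrN//; first by rewrite opprK; ring.
exact: cst_continuous.
Qed.

Lemma Rintegral_box_sin g s : 0 < g -> \int[mu]_x (box g x * sin (x * s)) = 0.
Proof.
move=> g0; have [->|s0] := eqVneq s 0.
  under eq_Rintegral do rewrite mulr0 sin0 mulr0.
  by rewrite /Rintegral integral0.
have dF (x : R) : is_derive x 1 (fun x => - (s^-1 * cos (x * s))) (sin (x * s)).
  by apply: is_derive_eq; rewrite /GRing.scale/=; field.
rewrite Rintegral_boxM (Rintegral_itv_FTC _ _ dF) ?gtrN//.
- by rewrite mulNr cosN subrr.
- exact: continuous_sin_linear.
Qed.

Lemma box_hatE g s : 0 < g -> s != 0 -> box_hat g s = 2 * sin (g * s) / s.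
Proof.
move=> g0 s0.
have dF (x : R) : is_derive x 1 (fun x => s^-1 * sin (x * s)) (cos (x * s)).
  by apply: is_derive_eq; rewrite /GRing.scale/=; field.
rewrite /box_hat Rintegral_boxM (Rintegral_itv_FTC _ _ dF) ?gtrN//.
- by rewrite mulNr sinN; field.
- exact: continuous_cos_linear.
Qed.

Lemma box_hat0 g : 0 < g -> box_hat g 0 = 2 * g.
Proof.
by move=> g0; rewrite -Rintegral_box//; apply: eq_Rintegral => x _; rewrite mulr0 cos0 mulr1.
Qed.

Lemma box_ge0 g x : 0 <= box g x.
Proof. by rewrite /box indicE. Qed.

Lemma box_hat_bound g s : 0 < g -> `|box_hat g s| <= 2 * g.
Proof.
move=> g0; have I := integrableM_cos s (integrable_box g).
apply: le_trans (le_normr_Rintegral measurableT I) _.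
rewrite -Rintegral_box//; apply: le_Rintegral => //.
- exact: integrable_norm.
- exact: integrable_box.
- by move=> x _; rewrite normrM ger0_norm ?box_ge0// ler_piMr ?box_ge0 ?normr_cos_le1.
Qed.

Lemma continuous_box_hat g : continuous (box_hat g).
Proof.
move=> s.
apply: (@continuity_under_integral _ _ _ mu (fun l x => box g x * cos (x *
  l)) setT measurableT (s - 1) (s + 1) _ _ (box g)) => //.
- by move=> l _; exact: integrableM_cos (integrable_box g).
- apply: aeW => x _ l _; apply: cvgMl_tmp.
  apply: (@continuous_comp _ _ _ (fun l : R => x * l) (@cos R)); last exact: continuous_cos.
  exact: mulrl_continuous.
- exact: integrable_box.
- by move=> l _; apply: aeW => x _; rewrite normrM ger0_norm ?box_ge0// ler_piMr ?box_ge0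
  ?normr_cos_le1.
- by rewrite inE/= in_itv/=; lra.
Qed.
End Box.

(** * Fourier inversion *)

Section Approx.
Variables (R : realType) (n : nat).
Local Notation mu := (@lebesgue_measure R).
Local Notation mud := (lebesgue_Rn R n).

(** Continuity at [xi] for the maximum norm: outside a cube around [xi] some coordinate is far,
    which is what [poisson_tail] controls. *)
Definition box_continuous (G : Rn R n -> R) (xi : Rn R n) :=
  forall k : R, 0 < k -> exists2 d : R, 0 < d &
    forall eta, (forall i, `|tnth eta i - tnth xi i| < d) -> `|G eta - G xi| < k.

Lemma Rintegral_sumRn (I : Type) (s : seq I) (f : I -> Rn R n -> R) :
  (forall i, mud.-integrable setT (EFin \o f i)) ->
  mud.-integrable setT (EFin \o (fun x => \sum_(i <- s) f i x)) /\
  \int[mud]_x \sum_(i <- s) f i x = \sum_(i <- s) \int[mud]_x f i x.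
Proof.
move=> If; elim: s => [|a s [IH1 IH2]].
  split.
    by apply: eq_integrable (integrable0 _ _) => // x _; rewrite /= big_nil.
  by under eq_Rintegral do rewrite big_nil; rewrite big_nil /Rintegral integral0.
have E : (fun x => \sum_(i <- a :: s) f i x) = (fun x => f a x + \sum_(i <- s) f i x).
  by apply/funext => x; rewrite big_cons.
rewrite E big_cons -IH2 RintegralD//; split=> //.
by apply: eq_integrable (integrableD _ (If a) IH1).
Qed.

(** On a small cube around [xi] the oscillation of G is below k / 2. The complement is covered by
    one slab per coordinate, each of mass O(e), and there G is bounded by K. *)
Lemma poisson_approx (G : Rn R n -> R) (K : R) (xi : Rn R n) (w : 'I_n -> R) :
  measurable_fun setT G -> (forall eta, `|G eta| <= K) -> box_continuous G xi ->
  (forall i, 2 * pi * tnth xi i = w i) ->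
  \int[mud]_eta (G eta * \prod_i poisson e (2 * pi * tnth eta i - w i)) @[e --> 0^'+] --> G xi.
Proof.
move=> mG GK cG xw.
apply/cvgrPdist_le => k k0.
have k20 : 0 < k / 2 by rewrite divr_gt0.
have [d d0 dG] := cG _ k20.
have tail i := poisson_tail (xw i) d0.
pose C i := sval (cid2 (tail i)).
have C0 i : 0 <= C i by rewrite /C; case: cid2.
have Ct i : forall e : R, 0 < e ->
    mu.-integrable setT (EFin \o (fun y => (d <= `|y - tnth xi i|)%R%:R * poisson e (2 * pi *
      y - w i))) /\
    \int[mu]_y ((d <= `|y - tnth xi i|)%R%:R * poisson e (2 * pi * y - w i)) <= C i * e.
  by rewrite /C; case: cid2.
have K0 : 0 <= K := le_trans (normr_ge0 _) (GK xi).
pose S := \sum_i C i.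
have S0 : 0 <= S by apply: sumr_ge0.
have D0 : 0 < 2 * K * S + 1 by rewrite ltr_wpDl// !mulr_ge0.
near=> e.
have e0 : 0 < e by near: e; exact: nbhs_right_gt.
(* Makes the far contribution [2 * K * S * e] at most k / 2; the [+ 1] keeps the divisor
   positive. *)
have eS : e <= k / 2 / (2 * K * S + 1).
  by near: e; apply: nbhs_right_le; rewrite !divr_gt0.
pose Q (eta : Rn R n) := \prod_i poisson e (2 * pi * tnth eta i - w i).
have Q0 eta : 0 <= Q eta by apply: prodr_ge0 => i _; exact: poisson_ge0.
have [IQ JQ] := Rintegral_prodRn (fun i => (Rintegral_poisson (w i) e0).1).
have {}JQ : \int[mud]_eta Q eta = 1.
  by rewrite JQ big1// => i _; rewrite (Rintegral_poisson (w i) e0).2.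
(* Restricted to the slab where coordinate i is far, the kernel is still a product; its other
   factors have integral 1, so only a one-dimensional tail remains. *)
pose h (i j : 'I_n) (y : R) := if j == i then (d <= `|y - tnth xi i|)%R%:R * poisson e (2 * pi *
  y - w i)
    else poisson e (2 * pi * y - w j).
have Ih i j : mu.-integrable setT (EFin \o h i j).
  rewrite /h; case: eqVneq => _; first exact: (Ct i e e0).1.
  exact: (Rintegral_poisson (w j) e0).1.
pose H i (eta : Rn R n) := (d <= `|tnth eta i - tnth xi i|)%R%:R * Q eta.
have HE i eta : H i eta = \prod_j h i j (tnth eta j).
  rewrite /H /Q (bigD1 i)//= [RHS](bigD1 i)//= mulrA /h eqxx; congr (_ * _).
  by apply: eq_bigr => j /negPf ->.
have IH i : mud.-integrable setT (EFin \o H i).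
  by apply: eq_integrable (Rintegral_prodRn (Ih i)).1 => // eta _; rewrite /= HE.
have JH i : \int[mud]_eta H i eta <= C i * e.
  under eq_Rintegral do rewrite HE.
  rewrite (Rintegral_prodRn (Ih i)).2 (bigD1 i)//= big1 ?mulr1.
    by rewrite {1}/h eqxx; exact: (Ct i e e0).2.
  by move=> j /negPf ji; rewrite /h ji (Rintegral_poisson (w j) e0).2.
have [IHs JHs] := Rintegral_sumRn (index_enum _) IH.
have GG eta : `|G eta - G xi| <= 2 * K.
  by rewrite (le_trans (ler_normB _ _))// mulr2n mulrDl !mul1r lerD.
have mQ : measurable_fun setT Q := integrable_measurable IQ.
have IGQ : mud.-integrable setT (EFin \o (fun eta => G eta * Q eta)).
  apply: le_integrable (integrableZl measurableT K IQ) => //.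
    by apply/measurable_EFinP/measurable_funM.
  move=> x _ /=; rewrite lee_fin normrM (ger0_norm (Q0 x)) normrM (ger0_norm K0) (ger0_norm (Q0
    _)).
  by rewrite ler_wpM2r.
have -> : G xi - \int[mud]_eta (G eta * Q eta) = - \int[mud]_eta (G eta * Q eta - G xi * Q eta).
  rewrite RintegralB//; last by apply: eq_integrable (integrableZl measurableT (G xi) IQ).
  by rewrite RintegralZl// JQ mulr1 opprB.
have Id : mud.-integrable setT (EFin \o (fun eta => G eta * Q eta - G xi * Q eta)).
  apply: eq_integrable (integrableB _ IGQ (integrableZl measurableT (G xi) IQ)) => //.
rewrite normrN (le_trans (le_normr_Rintegral measurableT Id))//.
have IB : mud.-integrable setT (EFin \o (fun eta => k / 2 * Q eta + 2 * K * \sum_i H i eta)).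
  by apply: eq_integrable (integrableD _ (integrableZl measurableT (k / 2) IQ) (integrableZl
    measurableT (2 * K) IHs)).
apply: (@le_trans _ _ (\int[mud]_eta (k / 2 * Q eta + 2 * K * \sum_i H i eta))).
  apply: le_Rintegral => //; first exact: integrable_norm.
  move=> eta _; rewrite -mulrBl normrM (ger0_norm (Q0 eta)).
  have H0 i : 0 <= H i eta by rewrite mulr_ge0.
  have [far|/existsNP[i /negP]] := pselect (forall i, `|tnth eta i - tnth xi i| < d).
    rewrite -[leLHS]addr0 lerD//; last by rewrite !mulr_ge0// sumr_ge0.
    by rewrite ler_wpM2r// ltW// dG.
  rewrite -leNgt => di; rewrite -[leLHS]add0r lerD// ?mulr_ge0// ?divr_ge0 ?(ltW k0)//.
  apply: (@le_trans _ _ (2 * K * Q eta)); first by rewrite ler_wpM2r.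
  rewrite ler_wpM2l ?mulr_ge0// (bigD1 i)//= {1}/H di mul1r lerDl sumr_ge0//.
rewrite RintegralD//; last 2 first.
- exact: (integrableZl measurableT (k / 2) IQ).
- exact: (integrableZl measurableT (2 * K) IHs).
rewrite !RintegralZl// JQ mulr1 JHs [leRHS](splitr k) lerD2l.
apply: (@le_trans _ _ (2 * K * (S * e))).
  by rewrite ler_wpM2l ?mulr_ge0// mulr_suml ler_sum.
move: eS; rewrite ler_pdivlMr// mulrA => eS; apply: le_trans eS.
by rewrite [leLHS]mulrC ler_pM2l// lerDl.
Unshelve. all: by end_near. Qed.
End Approx.

Lemma eq_integrableT d (T : measurableType d) (R : realType) (m : {measure set T -> \bar R})
    (f g : T -> R) : (forall x, f x = g x) ->
  m.-integrable setT (EFin \o f) -> m.-integrable setT (EFin \o g).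
Proof. by move=> /funext ->. Qed.

Section Fubini.
Context d1 d2 (T1 : measurableType d1) (T2 : measurableType d2) (R : realType).
Variables (m1 : {sigma_finite_measure set T1 -> \bar R})
  (m2 : {sigma_finite_measure set T2 -> \bar R}).

(** Integrability of every section makes the real-valued inner integrals agree with the extended
    ones at every point, not just almost everywhere. *)
Lemma Rintegral_fubini (F : T1 * T2 -> R) :
  (m1 \x m2)%E.-integrable setT (EFin \o F) ->
  (forall x, m2.-integrable setT (EFin \o (fun y => F (x, y)))) ->
  (forall y, m1.-integrable setT (EFin \o (fun x => F (x, y)))) ->
  m1.-integrable setT (EFin \o (fun x => \int[m2]_y F (x, y))) /\
  \int[m1]_x \int[m2]_y F (x, y) = \int[m2]_y \int[m1]_x F (x, y).
Proof.
move=> IF I2 I1.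
have E2 x : ((\int[m2]_y F (x, y))%:E = \int[m2]_y (F (x, y))%:E)%E.
  by rewrite /Rintegral fineK//; exact: integrable_fin_num (I2 x).
have E1 y : ((\int[m1]_x F (x, y))%:E = \int[m1]_x (F (x, y))%:E)%E.
  by rewrite /Rintegral fineK//; exact: integrable_fin_num (I1 y).
split.
  by apply: eq_integrable (integrable_fubini_F IF) => // x _; rewrite /= E2.
rewrite [LHS]/Rintegral [RHS]/Rintegral.
under eq_integral do rewrite E2.
under [in RHS]eq_integral do rewrite E1.
congr fine; exact: Fubini IF.
Qed.
End Fubini.

Section Duality.
Variables (R : realType) (n : nat).
Local Notation mu := (@lebesgue_measure R).
Local Notation mud := (lebesgue_Rn R n).
Implicit Types (x eta xi : Rn R n) (G : Rn R n -> R) (w : 'I_n -> R).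

(** The real part of the inverse Fourier transform of a real function. *)
Definition cosine_transform G x := \int[mud]_eta (G eta * cos (\sum_i tnth x i * (2 * pi *
  tnth eta i))).

(** The weight exp (- e |x|_1): being a product, it has a product of Poisson kernels as Fourier
    transform. *)
Definition damping (e : R) x := \prod_i expabs e (tnth x i).

Lemma damping_itv (e : R) x : 0 < e -> 0 <= damping e x <= 1.
Proof.
move=> e0; apply/andP; split; first by apply: prodr_ge0 => i _; exact: expR_ge0.
apply: prodr_ile1 => i _; rewrite expR_ge0/= -[leRHS]expR0 ler_expR oppr_le0.
by rewrite mulr_ge0// ltW.
Qed.

Lemma integrable_damping (e : R) : 0 < e -> mud.-integrable setT (EFin \o damping e).
Proof.
move=> e0; have [I _ _] := Rintegral_expabs_char 0 e0.
by have [] := @Rintegral_prodRn R n (fun=> expabs e) (fun=> I).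
Qed.

Lemma Rintegral_damping_cos (e : R) w : 0 < e ->
  \int[mud]_x (damping e x * cos (\sum_i tnth x i * w i)) = \prod_i poisson e (w i).
Proof.
move=> e0.
have Ie i := let: And3 h _ _ := Rintegral_expabs_char (w i) e0 in h.
have Ce i := let: And3 _ h _ := Rintegral_expabs_char (w i) e0 in h.
have Se i := let: And3 _ _ h := Rintegral_expabs_char (w i) e0 in h.
rewrite (Rintegral_prodRn_char Ie Se).1.
by apply: eq_bigr => i _; exact: Ce.
Qed.

Lemma measurable_bilinear_form :
  measurable_fun setT (fun z : Rn R n * Rn R n => \sum_i tnth z.1 i * (2 * pi * tnth z.2 i)).
Proof.
apply: measurable_sum => i; apply: measurable_funM.
  exact: measurableT_comp (measurable_tnth i) measurable_fst.
apply: measurable_funM => //.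
exact: measurableT_comp (measurable_tnth i) measurable_snd.
Qed.

Lemma poisson_le (e s : R) : 0 < e -> poisson e s <= 2 / e.
Proof.
move=> e0; rewrite /poisson ler_pdivrMr; last by rewrite ltr_wpDr ?sqr_ge0// exprn_gt0.
have -> : 2 / e * (e ^+ 2 + s ^+ 2) = 2 * e + 2 / e * s ^+ 2 by field; rewrite gt_eqF.
by rewrite lerDl mulr_ge0 ?sqr_ge0// divr_ge0// ltW.
Qed.

Lemma integrableM_poisson G (e : R) (v : 'I_n -> R) : mud.-integrable setT (EFin \o G) -> 0 < e ->
  mud.-integrable setT (EFin \o (fun y => G y * \prod_i poisson e (2 * pi * tnth y i - v i))).
Proof.
move=> IG e0.
have mP : measurable_fun setT (fun y : Rn R n => \prod_i poisson e (2 * pi * tnth y i - v i)).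
  apply: (@measurable_prodRn _ _ (fun i y => poisson e (2 * pi * y - v i))) => i.
  exact: integrable_measurable (Rintegral_poisson (v i) e0).1.
have mG := integrable_measurable IG.
apply: le_integrable (integrableZl measurableT (\prod_(i < n) (2 / e)) IG) => //.
  exact/measurable_EFinP/measurable_funM.
move=> z _ /=; rewrite lee_fin !normrM mulrC ler_wpM2r// ger0_norm; last first.
  by apply: prodr_ge0 => i _; exact: poisson_ge0.
apply: le_trans (ler_norm _); apply: ler_prod => i _.
by rewrite poisson_ge0// poisson_le.
Qed.

(** Product-to-sum formula: testing at frequency w centres one kernel at w and one at -w, whence the
    half-sums over opposite points below. *)
Lemma Rintegral_damping_cosM (e : R) w (v : 'I_n -> R) : 0 < e ->
  \int[mud]_x (damping e x * cos (\sum_i tnth x i * w i) * cos (\sum_i tnth x i * v i)) =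
  2^-1 * (\prod_i poisson e (v i - w i) + \prod_i poisson e (v i - - w i)).
Proof.
move=> e0; have Id := integrable_damping e0.
have I1 := integrableM_cosRn (fun i => v i - w i) Id.
have I2 := integrableM_cosRn (fun i => v i - - w i) Id.
have I12 : mud.-integrable setT (EFin \o (fun x => damping e x * cos (\sum_i tnth x i *
  (v i - w i)) +
    damping e x * cos (\sum_i tnth x i * (v i - - w i)))).
  by apply: eq_integrableT (integrableD measurableT I1 I2).
rewrite -!(Rintegral_damping_cos _ e0) -(RintegralD measurableT I1 I2) -(RintegralZl _
  measurableT I12).
apply: eq_Rintegral => x _.
have sE (u : 'I_n -> R) : \sum_i tnth x i * (v i - u i) =
    \sum_i tnth x i * v i - \sum_i tnth x i * u i.
  by rewrite -sumrB; apply: eq_bigr => i _; rewrite mulrBr.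
rewrite !sE (_ : \sum_i tnth x i * - w i = - \sum_i tnth x i * w i); last first.
  by rewrite -sumrN; apply: eq_bigr => i _; rewrite mulrN.
by rewrite opprK !cosD cosN sinN; field.
Qed.

Lemma cosine_transform_damped G (e : R) w : mud.-integrable setT (EFin \o G) -> 0 < e ->
  mud.-integrable setT (EFin \o (fun x => cosine_transform G x * (damping e x *
    cos (\sum_i tnth x i * w i)))) /\
  \int[mud]_x (cosine_transform G x * (damping e x * cos (\sum_i tnth x i * w i))) =
  2^-1 * (\int[mud]_eta (G eta * \prod_i poisson e (2 * pi * tnth eta i - w i)) +
          \int[mud]_eta (G eta * \prod_i poisson e (2 * pi * tnth eta i - - w i))).
Proof.
move=> IG e0.
have Id := integrable_damping e0.
pose D x := damping e x * cos (\sum_i tnth x i * w i).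
have ID : mud.-integrable setT (EFin \o D) := integrableM_cosRn w Id.
pose F (z : Rn R n * Rn R n) := D z.1 * G z.2 * cos (\sum_i tnth z.1 i * (2 * pi * tnth z.2 i)).
(* This is what the damping is for: the integrand is absolutely integrable in both variables
   jointly. *)
have IF : (mud \x mud)%E.-integrable setT (EFin \o F).
  apply: integrableM_le1; first exact: integrable_prodM.
    exact: measurableT_comp (@measurable_cosR R) measurable_bilinear_form.
  by move=> z; exact: normr_cos_le1.
have sC x (y : Rn R n) : \sum_i tnth y i * (2 * pi * tnth x i) =
    \sum_i tnth x i * (2 * pi * tnth y i).
  by apply: eq_bigr => i _; ring.
have IGc x : mud.-integrable setT
    (EFin \o (fun y => G y * cos (\sum_i tnth x i * (2 * pi * tnth y i)))).
  have I := integrableM_cosRn (fun i => 2 * pi * tnth x i) IG.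
  by apply: eq_integrableT I => y; rewrite sC.
have FE x y : F (x, y) = D x * (G y * cos (\sum_i tnth x i * (2 * pi * tnth y i))).
  by rewrite /F mulrA.
have FE' x y : F (x, y) = G y * (D x * cos (\sum_i tnth x i * (2 * pi * tnth y i))).
  by rewrite /F /=; ring.
have I2 x : mud.-integrable setT (EFin \o (fun y => F (x, y))).
  by apply: eq_integrableT (integrableZl measurableT (D x) (IGc x)) => y; rewrite FE.
have I1 y : mud.-integrable setT (EFin \o (fun x => F (x, y))).
  have I := integrableM_cosRn (fun i => 2 * pi * tnth y i) ID.
  by apply: eq_integrableT (integrableZl measurableT (G y) I) => x; rewrite FE'.
have [J1 J2] := Rintegral_fubini IF I2 I1.
have E1 : (fun x => \int[mud]_y F (x, y)) = (fun x => cosine_transform G x * D x).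
  apply/funext => x; rewrite /cosine_transform [RHS]mulrC -(RintegralZl _ measurableT (IGc x)).
  by apply: eq_Rintegral => y _; rewrite FE.
have E2 y : \int[mud]_x F (x, y) = 2^-1 * (G y * \prod_i poisson e (2 * pi * tnth y i - w i) +
     G y * \prod_i poisson e (2 * pi * tnth y i - - w i)).
  rewrite -mulrDr mulrCA -Rintegral_damping_cosM// -(RintegralZl _ measurableT); last first.
    exact: integrableM_cosRn ID.
  by apply: eq_Rintegral => x _; rewrite FE'.
have P1 := integrableM_poisson w IG e0.
have P2 := integrableM_poisson (fun i => - w i) IG e0.
clear I1 I2 IF ID Id IGc.
rewrite E1 in J1 J2; split; first exact: J1.
rewrite J2; under eq_Rintegral do rewrite E2.
rewrite (RintegralZl _ measurableT); first by rewrite (RintegralD measurableT P1 P2).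
by apply: eq_integrableT (integrableD measurableT P1 P2).
Qed.
End Duality.

(** A nonnegative integral is a supremum over the simple functions below the integrand, so
    monotonicity holds for arbitrary functions. It is applied to the modulus of a difference of
    solutions, whose measurability is never examined. *)
Lemma ge0_le_integralT d (T : measurableType d) (R : realType) (m : {measure set T -> \bar R})
    (f g : T -> \bar R) : (forall x, 0 <= f x)%E -> (forall x, f x <= g x)%E ->
  (\int[m]_x f x <= \int[m]_x g x)%E.
Proof.
move=> f0 fg; have g0 x : (0 <= g x)%E := le_trans (f0 x) (fg x).
rewrite !ge0_integralTE//; apply: ereal_sup_le => _ [h hf <-]; exists h => // x.
exact: le_trans (fg x).
Qed.

Section L1bound.
Variables (R : realType) (n : nat).
Local Notation mud := (lebesgue_Rn R n).

(* Testing the L^1 norm against a trigonometric polynomial of sup norm at most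
   1, damped by [damping e] so that Fubini applies; as [e] tends to 0 the
   Poisson kernels recover the values of G, which is Fourier inversion. *)
Lemma cosine_transform_L1_ge (G : Rn R n -> R) (K : R) (f : Rn R n -> \bar R)
    (m : nat) (c : 'I_m -> R) (w : 'I_m -> 'I_n -> R) (xi xi' : 'I_m -> Rn R n) :
  mud.-integrable setT (EFin \o G) -> (forall eta, `|G eta| <= K) ->
  (forall j i, 2 * pi * tnth (xi j) i = w j i) ->
  (forall j i, 2 * pi * tnth (xi' j) i = - w j i) ->
  (forall j, box_continuous G (xi j)) -> (forall j, box_continuous G (xi' j)) ->
  (forall x : Rn R n, `|\sum_j c j * cos (\sum_i tnth x i * w j i)| <= 1) ->
  (forall x, `|cosine_transform G x|%:E <= f x)%E ->
  (`|\sum_j c j * (2^-1 * (G (xi j) + G (xi' j)))|%:E <= \int[mud]_x f x)%E.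
Proof.
move=> IG GK xw xw' cG cG' c1 Wf.
have mG := integrable_measurable IG.
pose A j e := 2^-1 * (\int[mud]_eta (G eta * \prod_i poisson e (2 * pi * tnth eta i - w j i)) +
          \int[mud]_eta (G eta * \prod_i poisson e (2 * pi * tnth eta i - - w j i))).
have Acvg : `|\sum_j c j * A j e| @[e --> 0^'+] --> `|\sum_j c j * (2^-1 * (G (xi j) +
  G (xi' j)))|.
  apply: cvg_norm; apply: cvg_big => [|j _]; first exact: add_continuous.
  apply: cvgMl_tmp; apply: cvgMl_tmp; apply: cvgD.
    exact: poisson_approx mG GK (cG j) (xw j).
  exact: (poisson_approx (w := fun i => - w j i) mG GK (cG' j) (xw' j)).
(* The right-hand side does not involve e, so e may tend to 0 after the bound; it may also be
   infinite. *)
suff key e : 0 < e -> (`|\sum_j c j * A j e|%:E <= \int[mud]_x f x)%E.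
  case E : (\int[mud]_x f x)%E => [r| |].
  - rewrite lee_fin; apply: (cvgr_to_le Acvg); near=> e.
    by rewrite -lee_fin -E key//; near: e; exact: nbhs_right_gt.
  - by rewrite leey.
  - by have := key 1 ltr01; rewrite E.
move=> e0; pose P x := \sum_j c j * cos (\sum_i tnth x i * w j i).
pose W := cosine_transform G.
have [IW EW] : mud.-integrable setT (EFin \o (fun x => W x * (damping e x * P x))) /\
    \int[mud]_x (W x * (damping e x * P x)) = \sum_j c j * A j e.
  have Ij j : mud.-integrable setT (EFin \o (fun x => c j * (W x * (damping e x *
    cos (\sum_i tnth x i * w j i))))).
    by apply: eq_integrable (integrableZl measurableT (c j) (cosine_transform_damped (w j) IG
      e0).1).
  have [I J] := Rintegral_sumRn (index_enum _) Ij.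
  have PE x : W x * (damping e x * P x) = \sum_j c j * (W x * (damping e x *
    cos (\sum_i tnth x i * w j i))).
    by rewrite /P !mulr_sumr; apply: eq_bigr => j _; ring.
  split; first by apply: eq_integrable I => // x _; rewrite /= PE.
  under eq_Rintegral do rewrite PE.
  rewrite J; apply: eq_bigr => j _.
  by rewrite RintegralZl ?(cosine_transform_damped (w j) IG e0).2//;
    exact: (cosine_transform_damped (w j) IG e0).1.
rewrite -EW EFin_normr_Rintegral//.
apply: le_trans (le_abse_integral _ measurableT (measurable_int _ IW)) _.
apply: ge0_le_integralT => x; first exact: abse_ge0.
apply: le_trans (Wf x); rewrite lee_fin normrM ler_piMr// normrM.
by have /andP[d0 d1] := damping_itv x e0; rewrite mulr_ile1 ?(ger0_norm d0)//; exact: c1.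
Unshelve. all: by end_near. Qed.
End L1bound.

(** * The solution and its Fourier transform *)

Section HeatKernel.
Variables (R : realType) (n : nat).
Local Notation mu := (@lebesgue_measure R).
Local Notation mud := (lebesgue_Rn R n).
Implicit Types (x eta xi : Rn R n).

Definition heat (c alpha : R) xi := expR (- (c * (2 * pi * enorm xi) `^ alpha)).

(** The Fourier transform of the initial datum, by [fourier_init]. *)
Definition cube_hat (g : R) xi := g * \prod_i box_hat g (2 * pi * tnth xi i).

Lemma enorm_ge0 xi : 0 <= enorm xi.
Proof. exact: sqrtr_ge0. Qed.

Lemma heat_ge0 c alpha xi : 0 <= heat c alpha xi.
Proof. exact: expR_ge0. Qed.

Lemma heat_le1 c alpha xi : 0 <= c -> heat c alpha xi <= 1.
Proof. by move=> c0; rewrite -[leRHS]expR0 ler_expR oppr_le0 mulr_ge0// powR_ge0. Qed.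

Lemma measurable_enorm : measurable_fun setT (@enorm R n).
Proof.
apply: (@measurableT_comp _ _ _ _ _ _ (@Num.sqrt R)).
  by apply: continuous_measurable_fun; exact: sqrt_continuous.
apply: measurable_sum => i; apply: measurable_funM; exact: measurable_tnth.
Qed.

Lemma measurable_heat c alpha : measurable_fun setT (heat c alpha).
Proof.
apply: (@measurableT_comp _ _ _ _ _ _ (@expR R)) => //.
apply: (@measurableT_comp _ _ _ _ _ _ (@GRing.opp R)) => //.
apply: measurable_funM => //.
apply: (@measurableT_comp _ _ _ _ _ _ (fun a : R => a `^ alpha)); first exact: measurable_powR.
by apply: measurable_funM => //; exact: measurable_enorm.
Qed.

(** The exponent n matches the n Poisson factors of the majorant below. For s > 1 put L = ln s.
    Since exp (alpha L) >= (alpha L)^2 / 2, completing the square in c (alpha L)^2 / 2 - 2 n L gives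
    the constant 2 n^2 / (c alpha^2). *)
Lemma expR_powR_decay (c alpha s : R) : 0 < c -> 0 < alpha -> 0 <= s ->
  expR (- (c * s `^ alpha)) <= expR (2 * n%:R ^+ 2 / (c * alpha ^+ 2)) * (2 / (1 + s ^+ 2)) ^+ n.
Proof.
move=> c0 a0 s0; set N : R := n%:R; have N0 : 0 <= N by [].
have D0 : 0 < c * alpha ^+ 2 by rewrite mulr_gt0// exprn_gt0.
have d0 : 0 <= 2 * N ^+ 2 / (c * alpha ^+ 2) by rewrite divr_ge0 ?mulr_ge0 ?sqr_ge0// ltW.
have s20 : 0 < 1 + s ^+ 2 by rewrite ltr_pwDl ?sqr_ge0.
have [s1|s1] := leP s 1.
  apply: (@le_trans _ _ 1).
    by rewrite -[leRHS]expR0 ler_expR oppr_le0 mulr_ge0 ?powR_ge0 ?ltW.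
  rewrite -[leLHS]mulr1 ler_pM//; first by rewrite -[leLHS]expR0 ler_expR.
  by rewrite exprn_ege1// ler_pdivlMr// mul1r (_ : 2 = 1 + 1)// lerD2l expr_le1.
have sp : 0 < s by exact: lt_trans s1.
pose L := ln s; have L0 : 0 <= L by rewrite ln_ge0 ?ltW.
have sE : s = expR L by rewrite lnK.
have h1 : expR (- (2 * L)) <= 2 / (1 + s ^+ 2).
  rewrite expRN expRM_natl -sE.
  rewrite ler_pdivlMr// mulrDr mulr1 mulVf ?gt_eqF ?exprn_gt0//.
  rewrite (_ : 2 = 1 + 1)// lerD2r invf_le1 ?exprn_gt0//.
  by rewrite exprn_ege1// ltW.
apply: (@le_trans _ _ (expR (2 * N ^+ 2 / (c * alpha ^+ 2)) * expR (- (2 * L)) ^+ n)); last first.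
  by rewrite ler_wpM2l ?expR_ge0// lerXn2r// nnegrE ?expR_ge0// divr_ge0// ltW.
rewrite -expRM_natl -expRD ler_expR.
have aL : 0 <= alpha * L by rewrite mulr_ge0// ltW.
have := expR_ge1Dxn 1 aL.
have -> : s `^ alpha = expR (alpha * L) by rewrite /powR gt_eqF.
move: (expR _) => X; rewrite /= (_ : 2`!%:R = 2)// => hX.
rewrite -subr_ge0.
have -> : 2 * N ^+ 2 / (c * alpha ^+ 2) + n%:R * - (2 * L) - - (c * X) =
   (c / 2) * (alpha * L - 2 * N / (c * alpha)) ^+ 2 + c * (X - (alpha * L) ^+ 2 / 2).
  by rewrite -/N; field; rewrite !gt_eqF.
by rewrite addr_ge0// mulr_ge0 ?sqr_ge0// ?divr_ge0// ?(ltW c0)// subr_ge0; lra.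
Qed.

(** A product majorant reduces integrability to dimension one; it holds factor by factor because
    |xi_i| <= |xi|. *)
Lemma heat_le_poisson (c alpha : R) xi : 0 < c -> 0 < alpha ->
  heat c alpha xi <= expR (2 * n%:R ^+ 2 / (c * alpha ^+ 2)) * \prod_i poisson 1 (2 * pi *
    tnth xi i - 0).
Proof.
move=> c0 a0; have pi0 := @pi_gt0 R.
have s0 : 0 <= 2 * pi * enorm xi by rewrite !mulr_ge0 ?enorm_ge0// ltW.
apply: le_trans (expR_powR_decay c0 a0 s0) _.
rewrite ler_wpM2l ?expR_ge0//.
have -> : (2 / (1 + (2 * pi * enorm xi) ^+ 2)) ^+ n = \prod_(i < n) (2 / (1 +
  (2 * pi * enorm xi) ^+ 2)).
  by rewrite prodr_const card_ord.
apply: ler_prod => i _; rewrite divr_ge0 ?addr_ge0 ?sqr_ge0//=.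
rewrite /poisson mulr1 expr1n subr0 ler_wpM2l// lef_pV2 ?posrE ?ltr_pwDl ?sqr_ge0//.
rewrite lerD2l !exprMn ler_wpM2l ?mulr_ge0 ?sqr_ge0 ?(ltW pi0)//.
rewrite /enorm sqr_sqrtr; last by apply: sumr_ge0 => j _; rewrite -expr2 sqr_ge0.
rewrite /dotp (bigD1 i)//= -expr2 lerDl sumr_ge0// => j _; by rewrite -expr2 sqr_ge0.
Qed.

Lemma cube_hat_bound g xi : 0 < g -> `|cube_hat g xi| <= g * (2 * g) ^+ n.
Proof.
move=> g0; rewrite /cube_hat normrM (gtr0_norm g0) ler_wpM2l ?(ltW g0)//.
rewrite normr_prod; have -> : (2 * g) ^+ n = \prod_(i < n) (2 *
  g) by rewrite prodr_const card_ord.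
by apply: ler_prod => i _; rewrite normr_ge0 box_hat_bound.
Qed.

Lemma measurable_cube_hat g : measurable_fun setT (cube_hat g).
Proof.
apply: measurable_funM => //; apply: (@measurable_prodRn _ _ (fun i y => box_hat g (2 * pi *
  y))) => i.
apply: measurableT_comp; last exact: measurable_funM.
by apply: continuous_measurable_fun; exact: continuous_box_hat.
Qed.

Definition heat_hat c alpha g xi := heat c alpha xi * cube_hat g xi.

Lemma heat_hat_bound c alpha g xi : 0 < c -> 0 < g ->
  `|heat_hat c alpha g xi| <= g * (2 * g) ^+ n.
Proof.
move=> c0 g0; rewrite normrM ger0_norm ?heat_ge0//.
apply: le_trans (cube_hat_bound xi g0).
by rewrite ler_piMl// heat_le1// ltW.
Qed.

Lemma integrable_heat_hat c alpha g : 0 < c -> 0 < alpha -> 0 < g ->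
  mud.-integrable setT (EFin \o heat_hat c alpha g).
Proof.
move=> c0 a0 g0.
have [I _] := Rintegral_prodRn (fun i : 'I_n => (Rintegral_poisson 0 (@ltr01 R)).1).
apply: le_integrable (integrableZl measurableT
  (g * (2 * g) ^+ n * expR (2 * n%:R ^+ 2 / (c * alpha ^+ 2))) I) => //.
  by apply/measurable_EFinP/measurable_funM; [exact: measurable_heat|exact: measurable_cube_hat].
move=> xi _ /=; rewrite lee_fin; apply: le_trans (ler_norm _).
rewrite /heat_hat normrM mulrC -[leRHS]mulrA ler_pM ?cube_hat_bound//.
by rewrite ger0_norm ?heat_ge0// heat_le_poisson.
Qed.

(** The filter behind [box_continuous]; it gives access to the limit rules for sums, products and
    compositions. *)
Definition box_nbhs xi : set_system (Rn R n) := fun A => exists2 d : R, 0 < d &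
  forall eta, (forall i, `|tnth eta i - tnth xi i| < d) -> A eta.

Global Instance box_nbhs_filter xi : Filter (box_nbhs xi).
Proof.
split.
- by exists 1.
- move=> A B [d d0 dA] [d' d0' dB]; exists (Num.min d d'); first by rewrite lt_min d0.
  move=> eta h; split; [apply: dA|apply: dB] => i.
    by apply: lt_le_trans (h i) _; rewrite ge_min lexx.
  by apply: lt_le_trans (h i) _; rewrite ge_min lexx orbT.
- by move=> A B AB [d d0 dA]; exists d => // eta /dA; exact: AB.
Qed.

Lemma box_continuous_heat_hat c alpha g xi : 0 < enorm xi ->
  box_continuous (heat_hat c alpha g) xi.
Proof.
move=> xi0; pose F := box_nbhs xi.
have tF i : tnth eta i @[eta --> F] --> tnth xi i.
  apply/cvgrPdist_lt => k k0; exists k => // eta /(_ i).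
  by rewrite distrC.
suff G : heat_hat c alpha g eta @[eta --> F] --> heat_hat c alpha g xi.
  move=> k k0; have [d d0 h] := (cvgrPdist_lt _ _).1 G k k0.
  by exists d => // eta /h; rewrite distrC.
apply: cvgM.
  apply: (@continuous_cvg _ _ _ _ _ _ (@expR R)); first exact: continuous_expR.
  apply: cvgN; apply: cvgMl_tmp.
  apply: (@continuous_cvg _ _ _ _ _ _ (fun a : R => a `^ alpha)).
    (* Continuity of the power comes from its derivative at a positive argument, which is where [xi]
       must be nonzero. *)
    apply: differentiable_continuous; apply/derivable1_diffP.
    have p0 : 0 < 2 * pi * enorm xi by rewrite !mulr_gt0// pi_gt0.
    by have [] := is_derive1_powR alpha p0.
  apply: cvgMl_tmp; apply: (@continuous_cvg _ _ _ _ _ _ (@Num.sqrt R));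
    first exact: sqrt_continuous.
  apply: cvg_big => [|i _]; first exact: add_continuous.
  by apply: cvgM; exact: tF.
apply: cvgMl_tmp; apply: cvg_big => [|i _]; first exact: mul_continuous.
apply: (@continuous_cvg _ _ _ _ _ _ (box_hat g)); first exact: continuous_box_hat.
by apply: cvgMl_tmp; exact: tF.
Qed.
End HeatKernel.

Section Solution.
Variables (R : realType) (n : nat).
Local Notation mu := (@lebesgue_measure R).
Local Notation mud := (lebesgue_Rn R n).
Local Open Scope complex_scope.
Implicit Types (x eta xi : Rn R n).

Lemma init_prod (g : R) x : 0 < g -> init g x = (g * \prod_i box g (tnth x i))%:C.
Proof.
move=> g0; rewrite /init; congr ((g * _)%:C).
have cE i : (-1 <= tnth [tuple of map ( *%R g^-1) x] i <= 1) = (- g <= tnth x i <= g).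
  by rewrite tnth_map mulrC ler_pdivrMr// ler_pdivlMr// mulN1r mul1r.
have [h|/existsNP[i hi]] := pselect (forall i, - g <= tnth x i <= g).
  rewrite indicE mem_set; last by move=> i; rewrite cE.
  by rewrite big1// => i _; rewrite /box indicE mem_set//= in_itv/=.
rewrite indicE memNset; last by move=> /(_ i); rewrite cE.
by rewrite (bigD1 i)//= /box indicE memNset ?mul0r//= in_itv/=.
Qed.

Lemma dotpE x xi : 2 * pi * dotp x xi = \sum_i tnth x i * (2 * pi * tnth xi i).
Proof. by rewrite /dotp mulr_sumr; apply: eq_bigr => i _; ring. Qed.

(** The imaginary part vanishes because the box is even. *)
Lemma fourier_init (g : R) xi : 0 < g -> fourier (init g) xi = (cube_hat g xi)%:C.
Proof.
move=> g0.
have IB (i : 'I_n) := integrable_box g.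
have SB (i : 'I_n) := Rintegral_box_sin (2 * pi * tnth xi i) g0.
have [IP _] := Rintegral_prodRn IB.
have [C S] := Rintegral_prodRn_char IB SB.
rewrite /fourier /cintegral /cube_hat; congr (_ +i* _).
  rewrite -C -RintegralZl//; last exact: (integrableM_cosRn _ IP).
  apply: eq_Rintegral => x _; rewrite init_prod//= cosN dotpE; ring.
rewrite -[RHS](mulr0 (- g)) -S -RintegralZl//; last exact: (integrableM_sinRn _ IP).
apply: eq_Rintegral => x _; rewrite init_prod//= sinN dotpE; ring.
Qed.

Lemma Re_sol (a g alpha t : R) x : 0 < g -> 0 < t ->
  complex.Re (sol a g alpha x t) = cosine_transform (heat_hat (t * a) alpha g) x.
Proof.
move=> g0 t0; have fE : fourier (init g) = fun xi => (cube_hat g xi)%:C.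
  by apply/funext => xi; exact: fourier_init.
rewrite /sol gt_eqF// fE /inv_fourier /cintegral/= /cosine_transform.
apply: eq_Rintegral => xi _; rewrite dotpE /heat_hat /heat; ring.
Qed.

Lemma Re_le_normc (z : R[i]) : `|complex.Re z| <= ComplexField.Normc.normc z.
Proof.
case: z => u v /=; rewrite -sqrtr_sqr ler_sqrt ?lerDl ?sqr_ge0//.
by rewrite addr_ge0 ?sqr_ge0.
Qed.

Lemma integrableM_cos_dual (f : Rn R n -> R) x : mud.-integrable setT (EFin \o f) ->
  mud.-integrable setT (EFin \o (fun y => f y * cos (\sum_i tnth x i * (2 * pi * tnth y i)))).
Proof.
move=> If; have I := integrableM_cosRn (fun i => 2 * pi * tnth x i) If.
apply: eq_integrableT I => y; congr (_ * cos _); apply: eq_bigr => i _; ring.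
Qed.

Lemma normc_ge_Re (u v : R[i]) (p q r : R) : complex.Re u = p -> complex.Re v = q -> r = p - q ->
  `|r| <= ComplexField.Normc.normc (u - v).
Proof.
move=> <- <- ->; apply: le_trans (Re_le_normc _).
by case: u; case: v.
Qed.

Lemma L1norm_sol_ge (a g alpha beta t : R) (m : nat) (c : 'I_m -> R) (w : 'I_m -> 'I_n -> R)
    (xi xi' : 'I_m -> Rn R n) : 0 < t -> 0 < a -> 0 < g -> 0 < alpha -> 0 < beta ->
  (forall j i, 2 * pi * tnth (xi j) i = w j i) ->
  (forall j i, 2 * pi * tnth (xi' j) i = - w j i) ->
  (forall j, 0 < enorm (xi j)) -> (forall j, 0 < enorm (xi' j)) ->
  (forall x : Rn R n, `|\sum_j c j * cos (\sum_i tnth x i * w j i)| <= 1) ->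
  (`|\sum_j c j * (2^-1 *
      ((heat_hat (t * a) alpha g (xi j) - heat_hat (t * a) beta g (xi j)) +
       (heat_hat (t * a) alpha g (xi' j) - heat_hat (t * a) beta g (xi' j))))|%:E <=
   L1norm (fun x => (sol a g alpha x t - sol a g beta x t)%R))%E.
Proof.
move=> t0 a0 g0 al0 be0 xw xw' xi0 xi0' c1; have M0 : 0 < t * a by rewrite mulr_gt0.
have Ia := integrable_heat_hat n M0 al0 g0.
have Ib := integrable_heat_hat n M0 be0 g0.
pose G (y : Rn R n) := heat_hat (t * a) alpha g y - heat_hat (t * a) beta g y.
have IG : mud.-integrable setT (EFin \o G).
  by apply: eq_integrable (integrableB _ Ia Ib).
have cG y : 0 < enorm y -> box_continuous G y.
  move=> y0 k k0.
  have k20 : 0 < k / 2 by rewrite divr_gt0.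
  have [d d0 dG] := @box_continuous_heat_hat R n (t * a) alpha g y y0 _ k20.
  have [d' d0' dG'] := @box_continuous_heat_hat R n (t * a) beta g y y0 _ k20.
  exists (Num.min d d'); first by rewrite lt_min d0.
  move=> eta h.
  have h1 : `|heat_hat (t * a) alpha g eta - heat_hat (t * a) alpha g y| < k / 2.
    by apply: dG => i; apply: lt_le_trans (h i) _; rewrite ge_min lexx.
  have h2 : `|heat_hat (t * a) beta g eta - heat_hat (t * a) beta g y| < k / 2.
    by apply: dG' => i; apply: lt_le_trans (h i) _; rewrite ge_min lexx orbT.
  have -> : G eta - G y = (heat_hat (t * a) alpha g eta - heat_hat (t * a) alpha g y) -
      (heat_hat (t * a) beta g eta - heat_hat (t * a) beta g y) by rewrite /G; ring.
  by apply: le_lt_trans (ler_normB _ _) _; rewrite [ltRHS]splitr ltrD.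
apply: (cosine_transform_L1_ge (G := G) (K := g * (2 * g) ^+ n +
  g * (2 * g) ^+ n) IG _ xw xw' _ _ c1).
- by move=> y; apply: le_trans (ler_normB _ _) _; rewrite lerD ?heat_hat_bound.
- by move=> j; exact: cG.
- by move=> j; exact: cG.
- move=> x; rewrite lee_fin; apply: normc_ge_Re (Re_sol a alpha x g0 t0) (Re_sol a beta x g0 t0)
  _.
  rewrite /cosine_transform -(RintegralB measurableT (integrableM_cos_dual x Ia)
    (integrableM_cos_dual x Ib)).
  by apply: eq_Rintegral => y _; rewrite mulrBl.
Qed.
End Solution.

(** * Test frequencies on the first coordinate axis *)

Section Test.
Variables (R : realType) (n : nat).
Implicit Types (s c alpha g : R).

(** Dividing by 2 pi converts the angular frequency s to the normalization of [fourier]. *)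
Definition axis_point s : Rn R n.+1 := [tuple if i == ord0 then s / (2 * pi) else 0 | i < n.+1].

Lemma tnth_axis_point s i : 2 * pi * tnth (axis_point s) i = if i == ord0 then s else 0.
Proof.
rewrite tnth_mktuple; case: ifP; rewrite ?mulr0// => _.
by rewrite mulrC divfK// mulf_neq0 ?gt_eqF ?pi_gt0.
Qed.

Lemma enorm_axis_point s : 2 * pi * enorm (axis_point s) = `|s|.
Proof.
have p0 : 0 < 2 * pi :> R by rewrite mulr_gt0// pi_gt0.
rewrite /enorm /dotp big_ord_recl big1 ?addr0; last by move=> i _; rewrite tnth_mktuple mul0r.
rewrite tnth_mktuple/= -expr2 sqrtr_sqr normrM normfV (gtr0_norm p0).
by rewrite mulrC divfK// gt_eqF.
Qed.

Lemma box_hatN g s : box_hat g (- s) = box_hat g s.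
Proof. by apply: eq_Rintegral => x _; rewrite mulrN cosN. Qed.

(** The n other coordinates sit at frequency 0 and contribute the length 2 g each. *)
Lemma cube_hat_axis_point g s : 0 < g -> cube_hat g (axis_point s) = g * (2 * g) ^+ n *
  box_hat g s.
Proof.
move=> g0; rewrite /cube_hat big_ord_recl tnth_axis_point/=.
under eq_bigr do rewrite tnth_axis_point/= box_hat0//.
by rewrite prodr_const card_ord; ring.
Qed.

Lemma heat_hat_axis_point c alpha g s : 0 < g -> 0 < s ->
  heat_hat c alpha g (axis_point s) = expR (- (c * s `^ alpha)) * (g * (2 * g) ^+ n *
    box_hat g s).
Proof.
move=> g0 s0; rewrite /heat_hat /heat (cube_hat_axis_point _ g0) enorm_axis_point.
by rewrite (gtr0_norm s0).
Qed.

Lemma heat_hat_axis_pointN c alpha g s : 0 < g -> 0 < s ->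
  heat_hat c alpha g (axis_point (- s)) = expR (- (c * s `^ alpha)) * (g * (2 * g) ^+ n *
    box_hat g s).
Proof.
move=> g0 s0; rewrite /heat_hat /heat (cube_hat_axis_point _ g0) enorm_axis_point normrN.
by rewrite (gtr0_norm s0) box_hatN.
Qed.

(* At the odd multiples of [pi / (2 g)] the factor [sin (g s)] of the Fourier
   transform of the initial datum is 1 or -1. *)
Definition freq g (k : nat) : R := (2 * k + 1)%:R * (pi / (2 * g)).

Lemma freq_gt0 g k : 0 < g -> 0 < freq g k.
Proof. by move=> g0; rewrite mulr_gt0 ?divr_gt0 ?mulr_gt0 ?pi_gt0// addn1. Qed.

Lemma sin_freq g k : 0 < g -> sin (g * freq g k) = (-1) ^+ k.
Proof.
move=> g0; have -> : g * freq g k = pi *+ k + pi / 2.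
  by rewrite /freq natrD natrM -[pi *+ k]mulr_natl; move: (@pi R) => P; field; rewrite gt_eqF.
rewrite sinDpihalf; elim: k => [|k IH]; first by rewrite mulr0n cos0.
by rewrite mulrS addrC cosDpi IH exprS mulN1r.
Qed.

Lemma CL1norm_sol_ge (T a g alpha beta : R) (m : nat) (c : 'I_m -> R) (k : 'I_m -> nat) :
  0 < T -> 0 < a -> 0 < g -> 0 < alpha -> 0 < beta ->
  (forall y, `|\sum_j c j * cos (y * freq g (k j))| <= 1) ->
  (`|g * (2 * g) ^+ n * 2 * \sum_j c j * (-1) ^+ k j / freq g (k j) *
     (expR (- (T * a * freq g (k j) `^ alpha)) - expR (- (T * a * freq g (k j) `^ beta)))|%:E
   <= CL1norm T (fun (x : Rn R n.+1) t => (sol a g alpha x t - sol a g beta x t)%R))%E.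
Proof.
move=> T0 a0 g0 al0 be0 c1.
pose w (j : 'I_m) (i : 'I_n.+1) : R := if i == ord0 then freq g (k j) else 0.
have p0 : 0 < 2 * pi :> R by rewrite mulr_gt0// pi_gt0.
have e0 s : s != 0 -> 0 < enorm (axis_point s).
  by move=> s0; rewrite -(pmulr_rgt0 _ p0) enorm_axis_point normr_gt0.
have := @L1norm_sol_ge R n.+1 a g alpha beta T m c w (fun j => axis_point (freq g (k j)))
  (fun j => axis_point (- freq g (k j))) T0 a0 g0 al0 be0.
have h1 j i : 2 * pi * tnth (axis_point (freq g (k j))) i = w j i by rewrite tnth_axis_point.
have h2 j i : 2 * pi * tnth (axis_point (- freq g (k j))) i = - w j i.
  by rewrite tnth_axis_point /w; case: ifP; rewrite ?oppr0.
have h3 j : 0 < enorm (axis_point (freq g (k j))) by rewrite e0// gt_eqF// freq_gt0.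
have h4 j : 0 < enorm (axis_point (- freq g (k j))) by rewrite e0// oppr_eq0 gt_eqF// freq_gt0.
have h5 (x : Rn R n.+1) : `|\sum_j c j * cos (\sum_i tnth x i * w j i)| <= 1.
  have := c1 (tnth x ord0); congr (`|_| <= _); apply: eq_bigr => j _; congr (_ * cos _).
  by rewrite big_ord_recl big1 ?addr0// => i _; rewrite /w/= mulr0.
move=> /(_ h1 h2 h3 h4 h5) H.
apply: (@le_trans _ _ (L1norm (fun x : Rn R n.+1 => (sol a g alpha x T - sol a g beta x T)%R)));
  last first.
  by apply: ereal_sup_ubound; exists T => //=; rewrite in_itv/= lexx ltW.
apply: le_trans H; rewrite le_eqVlt; apply/orP; left; apply/eqP; congr (`|_|%:E).
rewrite mulr_sumr; apply: eq_bigr => j _.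
have f0 := freq_gt0 (k j) g0.
(* Opposite points give the same value, so each half-sum collapses to one term. *)
rewrite !heat_hat_axis_pointN// !heat_hat_axis_point// box_hatE ?gt_eqF// sin_freq//.
move: (expR _) (expR _) ((-1) ^+ _) f0 => X Y Z f0; field; rewrite gt_eqF//.
Qed.
End Test.

(** * Lower bounds for the Lipschitz constant *)

Section LipBound.
Variables (R : realType) (n : nat).
Implicit Types (s M alpha g : R).

Lemma heat_symbol_diffquot M s (lambda : R) : 0 < s ->
  (expR (- (M * s `^ (lambda + h))) - expR (- (M * s `^ lambda))) / h @[h --> 0^'] -->
  - (M * (s `^ lambda * ln s) * expR (- (M * s `^ lambda))).
Proof.
move=> s0.
have pE al : s `^ al = expR (al * ln s) by rewrite /powR gt_eqF.
have dF : is_derive lambda 1 (fun al => expR (- (M * expR (al * ln s))))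
    (- (M * (s `^ lambda * ln s) * expR (- (M * s `^ lambda)))).
  by apply: is_derive_eq; rewrite !pE /GRing.scale/=; ring.
have [D E] := dF.
rewrite -E; apply: cvg_trans D; apply: near_eq_cvg; near=> h.
by rewrite !pE /= /GRing.scale/= mulr1 [h + _]addrC mulrC.
Unshelve. all: by end_near. Qed.

Lemma Lip_ge (lambda T a g : R) (m : nat) (c : 'I_m -> R) (k : 'I_m -> nat) :
  0 < T -> 0 < a -> 0 < g -> 0 < lambda ->
  (forall y, `|\sum_j c j * cos (y * freq g (k j))| <= 1) ->
  (`|g * (2 * g) ^+ n * 2 * \sum_j c j * (-1) ^+ k j / freq g (k j) *
     (T * a * (freq g (k j) `^ lambda * ln (freq g (k j))) *
        expR (- (T * a * freq g (k j) `^ lambda)))|%:E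
   <= Lip n.+1 lambda T a g)%E.
Proof.
move=> T0 a0 g0 l0 c1; set L := (X in (`|X|%:E <= _)%E).
pose Q h := g * (2 * g) ^+ n * 2 * \sum_j c j * (-1) ^+ k j / freq g (k j) *
  ((expR (- (T * a * freq g (k j) `^ (lambda + h))) - expR (- (T * a *
    freq g (k j) `^ lambda))) / h).
(* The derivative in alpha carries a minus sign, which the absolute value absorbs. *)
have QL : `|Q h| @[h --> 0^'] --> `|L|.
  have -> : `|L| = `|g * (2 * g) ^+ n * 2 * \sum_j c j * (-1) ^+ k j / freq g (k j) *
     - (T * a * (freq g (k j) `^ lambda * ln (freq g (k j))) *
        expR (- (T * a * freq g (k j) `^ lambda)))|.
    rewrite -[LHS]normrN; congr `|_|; rewrite /L -mulrN; congr (_ * _).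
    by rewrite -sumrN; apply: eq_bigr => j _; rewrite mulrN.
  apply: cvg_norm; apply: cvgMl_tmp; apply: cvg_big => [|j _]; first exact: add_continuous.
  by apply: cvgMl_tmp; apply: heat_symbol_diffquot; exact: freq_gt0.
(* The limsup is an infimum over the sets V of the filter. Each V contains the pairs (lambda + h,
   lambda) with h small and nonzero, so the supremum over V dominates the limit along this path. *)
rewrite /Lip; apply: le_ereal_inf_tmp => _ [V FV <-].
set S := ereal_sup _.
have key : \forall h \near 0^', (`|Q h|%:E <= S)%E.
  have FV' : nbhs (lambda, lambda) [set p | p.1 != p.2 -> V p] by exact: FV.
  have [[A B] /= [nA nB] AB] := FV'.
  have cA : lambda + h @[h --> (0 : R)] --> lambda.
    by rewrite -[X in _ --> X]addr0; apply: cvgD; [exact: cvg_cst|exact: cvg_id].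
  have nV : \forall h \near (0 : R), h != 0 -> V (lambda + h, lambda).
    near=> h => h0; have Ah : A (lambda + h) by near: h; exact: (cA _ nA).
    have : [set p | p.1 != p.2 -> V p] (lambda + h, lambda).
      by apply: AB; split => //; exact: nbhs_singleton.
    by apply => /=; rewrite -subr_eq0 addrAC subrr add0r.
  near=> h.
  have h0 : h != 0 by near: h; exact: nbhs_dnbhs_neq.
  have lh0 : 0 < lambda + h.
    near: h; apply: nbhs_dnbhs.
    by apply: (cvgr_gt lambda cA).
  have Vh : V (lambda + h, lambda).
    by move: h0; near: h; apply: nbhs_dnbhs.
  apply: le_trans (ereal_sup_ubound (imageP _ Vh)); rewrite /=.
  have -> : (lambda + h - lambda) = h by rewrite addrAC subrr add0r.
  rewrite inver normr_eq0 (negPf h0).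
  have -> : Q h = (g * (2 * g) ^+ n * 2 * \sum_j c j * (-1) ^+ k j / freq g (k j) *
      (expR (- (T * a * freq g (k j) `^ (lambda + h))) - expR (- (T * a *
        freq g (k j) `^ lambda)))) / h.
    rewrite /Q -[RHS]mulrA; congr (_ * _); rewrite mulr_suml; apply: eq_bigr => j _.
    by rewrite !mulrA.
  rewrite normrM normfV EFinM lee_wpmul2r// ?lee_fin ?invr_ge0//.
  exact: CL1norm_sol_ge.
case E : S => [r| |].
- rewrite lee_fin; apply: (cvgr_to_le QL); near=> h.
  by rewrite -lee_fin -E; near: h.
- by rewrite leey.
- have /filter_ex[h] := key; by rewrite E.
Unshelve. all: by end_near. Qed.
End LipBound.

(** * Uniform bound for the partial sums of the square wave *)

Section SquareWave.
Variable R : realType.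
Implicit Types z : R.

Lemma normr_sin_natM (k : nat) z : `|sin (k%:R * z)| <= k%:R * `|sin z|.
Proof.
elim: k => [|k IH]; first by rewrite !mul0r sin0 normr0.
rewrite -[k.+1%:R]natr1 mulrDl mul1r sinD mulrDl mul1r.
apply: le_trans (ler_normD _ _) _; rewrite !normrM lerD//.
  by apply: le_trans IH; rewrite ler_piMr ?normr_cos_le1.
by rewrite ler_piMl ?normr_cos_le1.
Qed.

(** A telescoping identity: the sines of the odd multiples of z, multiplied by [sin z], sum to
    [sin (n z) ^+ 2], which stays in [0, 1]. *)
Lemma sin_oddM_sin (j : nat) z :
  sin ((2 * j + 1)%:R * z) * sin z = sin (j.+1%:R * z) ^+ 2 - sin (j%:R * z) ^+ 2.
Proof.
have -> : (2 * j + 1)%:R * z = j%:R * z + j.+1%:R * z by rewrite -natr1 natrD natrM; ring.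
have -> : j.+1%:R * z = j%:R * z + z by rewrite -natr1; ring.
have h2 := cos2Dsin2 z.
rewrite sinD (sinD (j%:R * z) z) (cosD (j%:R * z) z).
move: (sin (j%:R * z)) (cos (j%:R * z)) (sin z) (cos z) h2 => s c S C h2.
by rewrite sqrrD !exprMn (_ : C ^+ 2 = 1 - S ^+ 2); [ring|rewrite -h2 addrK].
Qed.

Definition square_wave (n : nat) z : R := \sum_(j < n) sin ((2 * j + 1)%:R * z) / (2 * j + 1)%:R.

Let b (j : nat) : R := (2 * j + 1)%:R^-1.
Let E (z : R) (j : nat) := sin (j%:R * z) ^+ 2.

(* Summation by parts against the partial sums [sin (n z) ^+ 2 / sin z]. *)
Lemma square_wave_tail m n z : (m <= n)%N ->
  b n * E z n - b m * E z m <= (square_wave n z - square_wave m z) * sin z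
    <= b m - b n + b n * E z n - b m * E z m.
Proof.
move=> mn; rewrite -(subnKC mn); move: (n - m)%N => {mn} d.
elim: d => [|d IH]; first by rewrite addn0; lra.
rewrite addnS; set i := (m + d)%N.
have -> : (square_wave i.+1 z - square_wave m z) * sin z =
    (square_wave i z - square_wave m z) * sin z + b i * (E z i.+1 - E z i).
  rewrite /square_wave big_ord_recr/= -/i /E -sin_oddM_sin /b; ring.
(* Both inequalities propagate because [b] decreases and [E] stays in [0, 1]. *)
have bb : b i.+1 <= b i by rewrite lef_pV2 ?posrE ?ltr0n ?addn1// ler_nat; lia.
have E0 : 0 <= E z i.+1 by exact: sqr_ge0.
have E1 : E z i.+1 <= 1.
  by rewrite /E -[leRHS](cos2Dsin2 (i.+1%:R * z)) lerDr sqr_ge0.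
have bE : 0 <= (b i - b i.+1) * E z i.+1 by rewrite mulr_ge0// subr_ge0.
have bE' : 0 <= (b i - b i.+1) * (1 - E z i.+1) by rewrite mulr_ge0// subr_ge0.
move: IH => /andP[]; rewrite -/i; lra.
Qed.

Lemma square_wave_head n z : `|square_wave n z| <= n%:R * `|sin z|.
Proof.
apply: le_trans (ler_norm_sum _ _ _) _.
have -> : n%:R * `|sin z| = \sum_(j < n) `|sin z| by rewrite sumr_const card_ord mulr_natl.
apply: ler_sum => j _; have j0 : 0 < (2 * j + 1)%:R :> R by rewrite ltr0n addn1.
by rewrite normrM normfV normr_nat ler_pdivrMr// [leRHS]mulrC normr_sin_natM.
Qed.

Lemma square_wave_bound n z : `|square_wave n z| <= 3.
Proof.
have [s0|s0] := eqVneq (sin z) 0.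
  by apply: le_trans (square_wave_head _ _) _; rewrite s0 normr0 mulr0.
have a0 : 0 < `|sin z| by rewrite normr_gt0.
have a1 := normr_sin_le1 z.
(* The sum is cut near 1 / |sin z|: the first m terms are at most |sin z| each, 2 in total, and the
   rest is at most [b m] / |sin z| <= 1. *)
pose m := (Num.truncn `|sin z|^-1).+1.
have i0 : 0 <= `|sin z|^-1 by rewrite invr_ge0.
have [m1 m2] : (m.-1%:R <= `|sin z|^-1) /\ `|sin z|^-1 < m%:R.
  by have /andP[] := Num.Theory.truncn_itv i0.
have ma : m%:R * `|sin z| <= 2.
  have -> : m%:R = m.-1%:R + 1 :> R by rewrite natr1.
  rewrite mulrDl mul1r (_ : 2 = 1 + 1)// lerD//.
  by rewrite -ler_pdivlMr// div1r.
have [nm|mn] := leqP n m.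
  apply: le_trans (square_wave_head _ _) _; apply: (@le_trans _ _ 2); last by rewrite ler_nat.
  by apply: le_trans ma; rewrite ler_wpM2r// ler_nat.
have /andP[t1 t2] := square_wave_tail z (ltnW mn).
have bm0 k : 0 < b k by rewrite invr_gt0 ltr0n addn1.
have E01 k : 0 <= E z k <= 1.
  by rewrite sqr_ge0/= /E -[leRHS](cos2Dsin2 (k%:R * z)) lerDr sqr_ge0.
have bE k : 0 <= b k * E z k <= b k.
  by have /andP[e0 e1] := E01 k; rewrite mulr_ge0 ?ler_piMr// ltW.
have tl : `|square_wave n z - square_wave m z| * `|sin z| <= b m.
  rewrite -normrM ler_norml.
  have /andP[] := bE m; have /andP[] := bE n; lra.
have bma : b m <= 1 * `|sin z|.
  rewrite mul1r /b -[leRHS]invrK lef_pV2 ?posrE ?invr_gt0 ?ltr0n ?addn1//.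
  by apply: ltW; apply: lt_le_trans m2 _; rewrite ler_nat; lia.
have {}tl : `|square_wave n z - square_wave m z| <= 1.
  by rewrite -(ler_pM2r a0); exact: le_trans bma.
have hd : `|square_wave m z| <= 2 := le_trans (square_wave_head _ _) ma.
rewrite -[square_wave n z](subrK (square_wave m z)).
by apply: le_trans (ler_normD _ _) _; rewrite (_ : 3 = 1 + 2)// lerD.
Qed.

(** At pi / 2 - u the square wave becomes a cosine sum whose alternating signs are those of
    [sin_freq]. *)
Lemma sin_oddM_pihalfB (j : nat) (u : R) : sin ((2 * j +
  1)%:R * (pi / 2 - u)) = (-1) ^+ j * cos ((2 * j + 1)%:R * u).
Proof.
have -> : (2 * j + 1)%:R * (pi / 2 - u) = (- ((2 * j + 1)%:R * u) + pi *+ j) + pi / 2.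
  by rewrite natrD natrM -[pi *+ j]mulr_natl; move: (@pi R) => P; field.
rewrite sinDpihalf; elim: j (_ * u) => [|j IH] v; first by rewrite mulr0n addr0 cosN mul1r.
by rewrite mulrSr addrA cosDpi IH exprS mulN1r mulNr.
Qed.
End SquareWave.

(** * Testing with one mode and with the square wave *)

Section LipTests.
Variables (R : realType) (n : nat).
Implicit Types (lambda T a g M r : R).

Lemma Lip_ge_single lambda T a g (k : nat) : 0 < T -> 0 < a -> 0 < g -> 0 < lambda ->
  ((g * (2 * g) ^+ n * 2 * (T * a * freq g k `^ (lambda - 1) * `|ln (freq g k)| *
      expR (- (T * a * freq g k `^ lambda))))%:E
   <= Lip n.+1 lambda T a g)%E.
Proof.
move=> T0 a0 g0 l0; set f := freq g k; have f0 : 0 < f := freq_gt0 k g0.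
have c1 y : `|\sum_(j < 1) 1 * cos (y * freq g k)| <= 1.
  by rewrite big_ord1 mul1r normr_cos_le1.
apply: le_trans (@Lip_ge R n lambda T a g 1 (fun=> 1) (fun=> k) T0 a0 g0 l0 c1).
rewrite big_ord1 lee_fin -/f mul1r.
have -> : f `^ (lambda - 1) = f `^ lambda / f.
  rewrite powRD; last by apply/implyP => _; rewrite gt_eqF.
  by rewrite powR_inv1 ?ltW.
have TA : 0 < T * a by rewrite mulr_gt0.
set P := f `^ lambda / f; set e := expR _.
have P0 : 0 <= P by rewrite divr_ge0 ?powR_ge0// ltW.
have A0 : 0 <= g * (2 * g) ^+ n * 2 * (T * a * P) 
  by rewrite (mulr_ge0 _ (mulr_ge0 (ltW TA) P0))// !mulr_ge0 ?exprn_ge0 ?mulr_ge0 ?ltW.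
have -> : g * (2 * g) ^+ n * 2 * ((-1) ^+ k / f * (T * a * (f `^ lambda * ln f) * e)) =
  (-1) ^+ k * (g * (2 * g) ^+ n * 2 * (T * a * P) * ln f * e) by rewrite /P; ring.
rewrite [leRHS]normrM normrX normrN1 expr1n mul1r normrM (ger0_norm (expR_ge0 _)) normrM
  (ger0_norm A0).
by rewrite -/e le_eqVlt; apply/orP; left; apply/eqP; ring.
Qed.

Lemma Lip1_ge_sum T a g (N : nat) : 0 < T -> 0 < a -> 0 < g ->
  ((g * (2 * g) ^+ n * 2 * (T * a / 3 *
     `|\sum_(j < N) ln (freq g j) * expR (- (T * a * freq g j)) / (2 * j + 1)%:R|))%:E
   <= Lip n.+1 1 T a g)%E.
Proof.
move=> T0 a0 g0.
(* The sign cancels the one in [Lip_ge], leaving the sign of each term to its logarithm; 1 / 3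
   compensates [square_wave_bound]. *)
pose c (j : 'I_N) : R := (-1) ^+ j / (2 * j + 1)%:R / 3.
have c1 y : `|\sum_j c j * cos (y * freq g j)| <= 1.
  have -> : \sum_j c j * cos (y * freq g j) = square_wave N (pi / 2 - y * (pi / (2 * g))) / 3.
    rewrite /square_wave mulr_suml; apply: eq_bigr => j _.
    by rewrite sin_oddM_pihalfB /c /freq mulrCA; ring.
  by rewrite normrM normfV normr_nat ler_pdivrMr// mul1r square_wave_bound.
apply: le_trans (@Lip_ge R n 1 T a g N c (fun j => j) T0 a0 g0 ltr01 c1).
have TA : 0 < T * a by rewrite mulr_gt0.
have K0 : 0 <= g * (2 * g) ^+ n * 2 by rewrite !mulr_ge0 ?exprn_ge0 ?mulr_ge0 ?ltW.
rewrite lee_fin [in leRHS]normrM (ger0_norm K0) ler_wpM2l//.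
rewrite -[X in X * `|_|](ger0_norm (_ : 0 <= T * a / 3)); last by rewrite divr_ge0 ?ltW.
rewrite -normrM le_eqVlt; apply/orP; left; apply/eqP; congr `|_|.
rewrite mulr_sumr; apply: eq_bigr => j _.
have f0 := freq_gt0 j g0; have j0 : (2 * j + 1)%:R != 0 :> R by rewrite pnatr_eq0 addn1.
rewrite powRr1 ?ltW// /c.
have s2 : (-1) ^+ j * (-1) ^+ j = 1 :> R by rewrite -exprMn mulrNN mul1r expr1n.
rewrite -[LHS]mul1r -[X in X * _ = _]s2; move: ((-1) ^+ j) (expR _) (ln _) => X Y Z.
move: j0 f0; move: ((2 * j + 1)%:R : R) (freq g j) => P Q P0 Q0.
by field; rewrite P0 gt_eqF.
Qed.

Lemma limf_einf_gt0 (F : set_system R) (f : R -> \bar R) r : 0 < r -> Filter F ->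
  (\forall x \near F, (r%:E <= f x)%E) -> (0 < limf_einf f F)%E.
Proof.
move=> r0 FF fr; apply: (@lt_le_trans _ _ r%:E); first by rewrite lte_fin.
rewrite /limf_einf leeNr; apply: le_trans (ereal_inf_lbound _) _.
  by exists [set x | (r%:E <= f x)%E]; [exact: fr|reflexivity].
by apply: ge_ereal_sup => _ [x fx <-]; rewrite leeN2; exact: fx.
Qed.

Lemma lee_div_ge (X : \bar R) (r s u : R) : 0 < s -> r * s <= u -> (u%:E <= X)%E ->
  (r%:E <= X / s%:E)%E.
Proof.
move=> s0 rs uX; rewrite inver gt_eqF//.
apply: (@le_trans _ _ ((r * s)%:E * (s^-1)%:E)%E).
  by rewrite -EFinM mulfK ?gt_eqF.
apply: lee_wpmul2r; first by rewrite lee_fin invr_ge0 ltW.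
by apply: le_trans uX; rewrite lee_fin.
Qed.
End LipTests.

(** * Asymptotics *)

Section Asymptotics.
Variable R : realType.
Implicit Types (lambda M g X theta : R).

Lemma ln_succ_le (N : nat) : ln (N.+2%:R : R) - ln (N.+1%:R : R) <= N.+1%:R^-1.
Proof.
have N0 : 0 < N.+1%:R :> R by rewrite ltr0n.
have -> : N.+2%:R = N.+1%:R * (1 + N.+1%:R^-1) :> R.
  by rewrite mulrDr mulr1 mulfV ?gt_eqF// natr1.
rewrite lnM ?posrE ?addr_gt0 ?invr_gt0// addrAC subrr add0r le_ln1Dx//.
by rewrite (lt_trans (ltrN10 _))// invr_gt0.
Qed.

(** Each new odd reciprocal is at least half a harmonic term, hence half an increment of the
    logarithm. *)
Lemma harmonic_odd_ge (N : nat) : 2^-1 * ln (N.+1%:R : R) <= \sum_(j < N) (2 * j + 1)%:R^-1.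
Proof.
elim: N => [|N IH]; first by rewrite big_ord0 ln1 mulr0.
rewrite big_ord_recr/=; have h := ln_succ_le N.
have : 2^-1 * N.+1%:R^-1 <= (2 * N + 1)%:R^-1 :> R.
  by rewrite -invfM -natrM lef_pV2 ?posrE ?ltr0n ?addn1// ler_nat; lia.
move: IH h; move: (\sum_(j < N) _) (ln _) (ln _) (N.+1%:R^-1) ((2 * N + 1)%:R^-1) => S A B U V;
  lra.
Qed.

(** Discrete form of the integral of ln x / x, by comparison with the increments of ln^2. The first
    term is ln 1 = 0, so the comparison starts at N = 1, whence the subtracted square of ln 2. *)
Lemma sum_ln_odd_ge (N : nat) :
  4^-1 * (ln (N.+1%:R : R) ^+ 2 - ln 2 ^+ 2) <= \sum_(j < N) ln ((2 * j + 1)%:R :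
    R) / (2 * j + 1)%:R.
Proof.
elim: N => [|[|N] IH].
- by rewrite big_ord0 ln1 expr0n/= sub0r pmulr_rle0// oppr_le0 sqr_ge0.
- by rewrite big_ord_recr big_ord0/= ln1 mul0r addr0 subrr mulr0.
rewrite big_ord_recr/=.
set M := N.+1 in IH *.
have h := ln_succ_le M.
have l0 : 0 <= ln (M.+1%:R : R) by rewrite ln_ge0// ler1n.
have l1 : ln (M.+1%:R : R) <= ln (M.+2%:R : R) by rewrite ler_ln ?posrE ?ltr0n// ler_nat.
(* True only for M >= 1, which is why N = 0 and N = 1 are separate base cases. *)
have l2 : ln (M.+2%:R : R) <= ln ((2 * M + 1)%:R : R).
  by rewrite ler_ln ?posrE ?ltr0n ?addn1// ler_nat /M; lia.
have i0 : 0 <= M.+1%:R^-1 :> R by rewrite invr_ge0.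
have hi : 2^-1 * M.+1%:R^-1 <= (2 * M + 1)%:R^-1 :> R.
  by rewrite -invfM -natrM lef_pV2 ?posrE ?ltr0n ?addn1// ler_nat; lia.
have h1 : (ln (M.+2%:R : R) - ln (M.+1%:R : R)) * (ln (M.+2%:R : R) + ln (M.+1%:R : R)) <=
    M.+1%:R^-1 * (ln (M.+2%:R : R) + ln (M.+2%:R : R)).
  by apply: ler_pM => //; rewrite ?subr_ge0// ?addr_ge0 ?lerD2l// (le_trans l0).
have h2 : ln (M.+2%:R : R) * (2^-1 * M.+1%:R^-1) <= ln ((2 * M + 1)%:R : R) * (2 * M + 1)%:R^-1.
  by apply: ler_pM => //; rewrite ?mulr_ge0// (le_trans l0).
move: IH h1 h2; move: (\sum_(j < M) _) (ln _) (ln (M.+1%:R)) (ln 2) (ln ((2 * M +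
  1)%:R)) => S A B C D.
move: (M.+1%:R^-1) ((2 * M + 1)%:R^-1) => U V; lra.
Qed.

(** Odd multiples of theta are 2 theta apart, so one of them lies within theta <= X / 2 of X. *)
Lemma freq_approx theta X : 0 < theta -> theta <= X / 2 ->
  exists k : nat, X / 2 <= (2 * k + 1)%:R * theta <= 2 * X.
Proof.
move=> t0 tX; have X0 : 0 < X by rewrite -(pmulr_lgt0 _ (_ : 0 < 2^-1))//; exact: lt_le_trans tX.
have q0 : 0 <= X / (2 * theta) by rewrite divr_ge0 ?mulr_ge0 ?ltW.
have /andP[k1 k2] := Num.Theory.truncn_itv q0.
exists (Num.truncn (X / (2 * theta))); move: (Num.truncn _) k1 k2 => k k1 k2.
move: k1; rewrite ler_pdivlMr ?mulr_gt0// => k1.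
move: k2; rewrite ltr_pdivrMr ?mulr_gt0// -natr1 => k2.
by rewrite natrD natrM; apply/andP; split; nra.
Qed.

Lemma powR_le_sqr X lambda : 1 <= X -> lambda <= 2 -> X `^ lambda <= X ^+ 2.
Proof. by move=> X1 l2; rewrite -powR_mulrn ?(le_trans ler01)// ler_powR. Qed.

(** X is the scale where M X^lambda = 1. For f in [X / 2, 2 X] the exponent M f^lambda is at most
    2^lambda <= 4, the weight M f^(lambda - 1) is at least 1 / (2 X), and ln f is at least half of
    ln X = |ln M| / lambda. *)
Lemma single_mode_gt1 lambda M theta (X := M `^ (- lambda^-1)) : 1 < lambda < 2 -> 0 < M ->
  0 < theta -> theta <= X / 2 -> 4 <= X ->
  exists k : nat, expR (- 4) / (4 * lambda) * (M `^ lambda^-1 * `|ln M|) <=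
    M * ((2 * k + 1)%:R * theta) `^ (lambda - 1) * `|ln ((2 * k + 1)%:R * theta)| *
    expR (- (M * ((2 * k + 1)%:R * theta) `^ lambda)).
Proof.
move=> /andP[l1 l2] M0 t0 tX X4.
have l0 : 0 < lambda := lt_trans ltr01 l1.
have X0 : 0 < X by exact: lt_le_trans X4.
have XM : M * X `^ lambda = 1.
  by rewrite /X -powRrM mulNr mulVf ?gt_eqF// powR_inv1 ?ltW// mulfV// gt_eqF.
have Xi : M `^ lambda^-1 = X^-1 by rewrite /X powRN invrK.
have lnX : ln X = - lambda^-1 * ln M by rewrite /X ln_powR.
(* Ensures that halving X loses at most half of its logarithm. *)
have L4 : 2 * ln 2 <= ln X.
  have -> : 2 * ln 2 = ln 4 :> R by rewrite (_ : 4 = 2 ^+ 2) ?lnXn//;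
    [rewrite mulr_natl|rewrite -natrX].
  by rewrite ler_ln ?posrE.
have ln20 : 0 < ln 2 :> R by rewrite ln_gt0// ltr1n.
have lnM' : `|ln M| = lambda * ln X.
  have -> : ln M = - (lambda * ln X) by rewrite lnX; field; rewrite gt_eqF.
  by rewrite normrN ger0_norm// mulr_ge0 ?ltW//; lra.
have [k /andP[fX1 fX2]] := freq_approx t0 tX; exists k.
move: ((2 * k + 1)%:R * theta) fX1 fX2 => f fX1 fX2.
have f0 : 0 < f by apply: lt_le_trans fX1; rewrite divr_gt0.
have lnf : 2^-1 * ln X <= ln f.
  have : ln (X / 2) <= ln f by rewrite ler_ln ?posrE ?divr_gt0.
  by rewrite ln_div ?posrE//; lra.
have lnf0 : 0 <= ln f by lra.
have pf : X `^ (lambda - 1) / 2 <= f `^ (lambda - 1).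
  apply: (@le_trans _ _ ((X / 2) `^ (lambda - 1))).
    rewrite powRM ?invr_ge0 ?(ltW X0)// ler_wpM2l ?powR_ge0//.
    rewrite -[in leRHS]powR_inv1// -powRrM mulN1r powRN lef_pV2 ?posrE ?powR_gt0//.
    by rewrite -[leRHS]powRr1// ler_powR ?ler1n//; lra.
  apply: ge0_ler_powR; rewrite ?nnegrE ?divr_ge0 ?(ltW X0) ?(ltW f0)//; lra.
have ef : expR (- 4) <= expR (- (M * f `^ lambda)).
  rewrite ler_expR lerN2.
  have h1 : f `^ lambda <= (2 * X) `^ lambda.
    by apply: ge0_ler_powR; rewrite ?nnegrE ?mulr_ge0 ?(ltW X0) ?(ltW f0) ?(ltW l0).
  have h2 : (2 * X) `^ lambda <= 4 * X `^ lambda.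
    rewrite powRM ?(ltW X0)// ler_wpM2r ?powR_ge0//.
    by have := @powR_le_sqr 2 lambda; rewrite ler1n => /(_ isT (ltW l2)); rewrite -natrX.
  have : M * f `^ lambda <= M * (4 * X `^ lambda) by rewrite ler_wpM2l ?(ltW M0)// (le_trans h1).
  by rewrite mulrCA XM mulr1.
rewrite (ger0_norm lnf0) lnM' Xi.
have -> : expR (- 4) / (4 * lambda) * (X^-1 * (lambda * ln X)) =
   M * (X `^ (lambda - 1) / 2) * (2^-1 * ln X) * expR (- 4).
  rewrite powRD; last by apply/implyP => _; rewrite gt_eqF.
  rewrite powR_inv1 ?(ltW X0)//.
  have -> : M * (X `^ lambda / X / 2) = M * X `^ lambda * (X^-1 / 2) by ring.
  by rewrite XM; field; rewrite !gt_eqF.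
have A0 : 0 <= X `^ (lambda - 1) / 2 by rewrite divr_ge0 ?powR_ge0.
have lX0 : 0 <= 2^-1 * ln X by lra.
have P0 := mulr_ge0 (ltW M0) A0.
apply: ler_pM; [exact: mulr_ge0|exact: expR_ge0| |exact: ef].
apply: ler_pM; [exact: P0|exact: lX0| |exact: lnf].
by rewrite ler_wpM2l ?(ltW M0).
Qed.
Lemma ln2_gt0 : 0 < ln 2 :> R.
Proof. by rewrite ln_gt0// ltr1n. Qed.

(** A mode in [2, 8], obtained with X = 4: its logarithm is at least ln 2 and its lambda-th power at
    most 8^2 = 64. *)
Lemma single_mode_gt1_large lambda M theta : 1 < lambda < 2 -> 0 < M ->
  0 < theta <= 2 ->
  exists k : nat, M * ln 2 * expR (- (64 * M)) <=
    M * ((2 * k + 1)%:R * theta) `^ (lambda - 1) * `|ln ((2 * k + 1)%:R * theta)| *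
    expR (- (M * ((2 * k + 1)%:R * theta) `^ lambda)).
Proof.
move=> /andP[l1 l2] M0 /andP[t0 t2].
have l0 : 0 < lambda := lt_trans ltr01 l1.
have t4 : theta <= 4 / 2 by lra.
have [k /andP[f1 f2]] := freq_approx t0 t4; exists k.
move: ((2 * k + 1)%:R * theta) f1 f2 => f f1 f2.
have f3 : 2 <= f by lra.
have f0 : 0 < f by lra.
have ln20 := ln2_gt0.
have lnf : ln 2 <= ln f by rewrite ler_ln ?posrE.
have pf : 1 <= f `^ (lambda - 1) by rewrite -[leLHS](powRr0 f) ler_powR; lra.
have ef : expR (- (64 * M)) <= expR (- (M * f `^ lambda)).
  rewrite ler_expR lerN2 mulrC ler_wpM2r ?(ltW M0)//.
  apply: (@le_trans _ _ (f ^+ 2)); first by rewrite powR_le_sqr ?(ltW l2)//; lra.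
  by rewrite expr2; nra.
rewrite (ger0_norm (le_trans (ltW ln20) lnf)).
apply: ler_pM; [by rewrite mulr_ge0 ?(ltW M0) ?(ltW ln20)|exact: expR_ge0| |exact: ef].
apply: ler_pM; [exact: ltW|exact: ltW| |exact: lnf].
by rewrite ler_peMr// ltW.
Qed.

(** For lambda < 1 the weight theta^(lambda - 1) grows as theta decreases, which favours the lowest
    mode, of order 1 / g. The power and the logarithm lose a factor 1 / 2 each, whence 1 / 4. *)
Lemma low_mode_lt1 lambda M g theta : 0 < lambda < 1 -> 0 < M -> 4 <= g ->
  0 < theta <= 2 / g ->
  M * expR (- M) / 4 * (g `^ (1 - lambda) * ln g) <=
    M * theta `^ (lambda - 1) * `|ln theta| * expR (- (M * theta `^ lambda)).
Proof.
move=> /andP[l0 l1] M0 g4 /andP[t0 tg].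
have g0 : 0 < g by lra.
have ln20 := ln2_gt0.
have lng : 2 * ln 2 <= ln g.
  have -> : 2 * ln 2 = ln 4 :> R by rewrite (_ : 4 = 2 ^+ 2) ?lnXn//;
    [rewrite mulr_natl|rewrite -natrX].
  by rewrite ler_ln ?posrE.
have lnt : ln theta <= ln 2 - ln g by rewrite -ln_div ?posrE// ler_ln ?posrE ?divr_gt0.
have nlt : 2^-1 * ln g <= `|ln theta| by rewrite ler0_norm; lra.
have g21 : 2 / g <= 1 by rewrite ler_pdivrMr// mul1r; lra.
have t1 : theta <= 1 by lra.
have pt : g `^ (1 - lambda) / 2 <= theta `^ (lambda - 1).
  rewrite -[lambda - 1]opprB powRN -[leLHS]invrK lef_pV2 ?posrE ?powR_gt0 ?invr_gt0 ?divr_gt0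
    ?powR_gt0//.
  apply: (@le_trans _ _ ((2 / g) `^ (1 - lambda))).
    by apply: ge0_ler_powR; rewrite ?nnegrE ?(ltW t0) ?divr_ge0 ?(ltW g0)//; lra.
  rewrite invf_div powRM ?invr_ge0 ?(ltW g0)// -[g^-1]powR_inv1 ?(ltW g0)// -powRrM mulN1r powRN.
  rewrite ler_wpM2r ?invr_ge0 ?powR_ge0//.
  by rewrite -[leRHS]powRr1// ler_powR ?ler1n//; lra.
have et : expR (- M) <= expR (- (M * theta `^ lambda)).
  rewrite ler_expR lerN2 ler_piMr ?(ltW M0)//.
  have e1 : 1 `^ lambda = 1 :> R by rewrite powR1.
  rewrite -[leRHS]e1; apply: ge0_ler_powR; rewrite ?nnegrE ?(ltW t0) ?(ltW l0)//.
have -> : M * expR (- M) / 4 * (g `^ (1 - lambda) * ln g) =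
    M * (g `^ (1 - lambda) / 2) * (2^-1 * ln g) * expR (- M) by field.
have P0 : 0 <= M * (g `^ (1 - lambda) / 2) by rewrite mulr_ge0 ?(ltW M0) ?divr_ge0 ?powR_ge0.
have L0 : 0 <= 2^-1 * ln g by lra.
apply: ler_pM; [exact: mulr_ge0|exact: expR_ge0| |exact: et].
apply: ler_pM; [exact: P0|exact: L0| |exact: nlt].
by rewrite ler_wpM2l ?(ltW M0).
Qed.

(** N is chosen so that every mode satisfies M F_j <= 1, which bounds the exponentials below by exp
    (- 1). As theta >= 1, ln F_j >= ln (2 j + 1) >= 0. With ln (N + 1) >= |ln M| / 2 and ln 2 <= |ln
    M| / 4, [sum_ln_odd_ge] yields 3 / 64 >= 1 / 32. *)
Lemma sum_modes_small_time M theta (F := fun j : nat => (2 * j + 1)%:R * theta) : 0 < M ->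
  1 <= theta ->
  2 * ln (2 * theta) <= - ln M -> 4 * ln 2 <= - ln M ->
  exists N : nat, expR (- 1) / 32 * ln M ^+ 2 <=
    `|\sum_(j < N) ln (F j) * expR (- (M * F j)) / (2 * j + 1)%:R|.
Proof.
move=> M0 t1 h1 h2; have t0 : 0 < theta := lt_le_trans ltr01 t1.
pose Z := (2 * M * theta)^-1.
have Z0 : 0 < Z by rewrite invr_gt0 !mulr_gt0.
have /andP[N1 N2] := Num.Theory.truncn_itv (ltW Z0).
set N := Num.truncn Z in N1 N2; exists N.
have lnZ : ln Z = - ln M - ln (2 * theta).
  by rewrite /Z (_ : 2 * M * theta = M * (2 * theta));
    [rewrite lnV ?lnM ?posrE ?mulr_gt0// opprD|ring].
have lnN : 2^-1 * - ln M <= ln (N.+1%:R : R).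
  apply: (@le_trans _ _ (ln Z)); first by rewrite lnZ; lra.
  by rewrite ler_ln ?posrE ?ltr0n// ltW.
have ln20 := ln2_gt0.
apply: (@le_trans _ _ (expR (- 1) * \sum_(j < N) ln ((2 * j + 1)%:R : R) / (2 * j + 1)%:R)).
  rewrite -mulrA ler_wpM2l ?expR_ge0//; apply: le_trans (sum_ln_odd_ge _).
  move: lnN h2 ln20; move: (ln (N.+1%:R)) (ln M) (ln 2) => A B C h3 h4 h5; nra.
rewrite (le_trans _ (ler_norm _))// mulr_sumr; apply: ler_sum => j _.
have j1 : 1 <= (2 * j + 1)%:R :> R by rewrite ler1n addn1.
have j0 : 0 < (2 * j + 1)%:R :> R := lt_le_trans ltr01 j1.
rewrite mulrA ler_wpM2r ?invr_ge0 ?(ltW j0)// mulrC.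
have lj : 0 <= ln ((2 * j + 1)%:R : R) by rewrite ln_ge0.
apply: ler_pM => //.
  by rewrite ler_ln ?posrE ?mulr_gt0// ler_peMr// ltW.
rewrite ler_expR lerN2 /F.
have : (2 * j + 1)%:R <= 2 * Z.
  apply: (@le_trans _ _ (2 * N%:R)); last by rewrite ler_wpM2l.
  by rewrite -natrM ler_nat addn1 ltn_pmul2l.
move=> jZ; apply: (@le_trans _ _ (M * (2 * Z * theta))).
  by rewrite ler_wpM2l ?(ltW M0)// ler_wpM2r ?(ltW t0).
by rewrite /Z le_eqVlt; apply/orP; left; apply/eqP; field; rewrite !gt_eqF.
Qed.

(** The sum stops at multiples of order X = theta^(-1/2): every F_j is then at most the square root
    of theta, so each logarithm is at most ln theta / 2 < 0. The odd harmonic sum supplies the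
    second logarithm, and 1 / 16 is 1 / 2 from the modes times 1 / 8 from that sum. *)
Lemma sum_modes_large_data M theta (F := fun j : nat => (2 * j + 1)%:R * theta) : 0 < M ->
  0 < theta ->
  4 * ln 2 <= - ln theta ->
  exists N : nat, expR (- M) / 16 * ln theta ^+ 2 <=
    `|\sum_(j < N) ln (F j) * expR (- (M * F j)) / (2 * j + 1)%:R|.
Proof.
move=> M0 t0 h; have ln20 := ln2_gt0.
pose X := expR (2^-1 * - ln theta).
have X0 : 0 < X := expR_gt0 _.
have X20 : 0 < X / 2 by rewrite divr_gt0.
have /andP[N1 N2] := Num.Theory.truncn_itv (ltW X20).
set N := Num.truncn _ in N1 N2; exists N.
have lnN : 4^-1 * - ln theta <= ln (N.+1%:R : R).
  apply: (@le_trans _ _ (ln (X / 2))); first by rewrite ln_div ?posrE// expRK; lra.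
  by rewrite ler_ln ?posrE ?ltr0n// ltW.
rewrite -normrN -sumrN (le_trans _ (ler_norm _))//.
apply: (@le_trans _ _ (\sum_(j < N) (2^-1 * - ln theta * expR (- M)) * (2 * j + 1)%:R^-1)).
  rewrite -mulr_sumr.
  apply: (@le_trans _ _ (2^-1 * - ln theta * expR (- M) * (2^-1 * (4^-1 * - ln theta)))).
    by rewrite le_eqVlt; apply/orP; left; apply/eqP; field.
  have A0 : 0 <= 2^-1 * - ln theta * expR (- M) by rewrite !mulr_ge0 ?expR_ge0//; lra.
  rewrite ler_wpM2l//; apply: le_trans (harmonic_odd_ge _).
  by rewrite ler_wpM2l.
apply: ler_sum => j _.
have j0 : 0 < (2 * j + 1)%:R :> R by rewrite ltr0n addn1.
have jX : (2 * j + 1)%:R <= X.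
  apply: (@le_trans _ _ (2 * N%:R)); last by move: N1; rewrite ler_pdivlMr// mulrC.
  by rewrite -natrM ler_nat addn1 ltn_pmul2l.
have tE : theta = expR (ln theta) by rewrite lnK.
have Ft : F j <= X * theta by rewrite ler_wpM2r ?(ltW t0).
have XtE : X * theta = expR (2^-1 * ln theta).
  by rewrite {1}tE /X -expRD; congr expR; field.
have lF : ln (F j) <= 2^-1 * ln theta.
  by rewrite -[leRHS]expRK -XtE ler_ln ?posrE ?mulr_gt0.
have F1 : F j <= 1.
  by apply: le_trans Ft _; rewrite XtE -[leRHS]expR0 ler_expR; lra.
rewrite -mulNr ler_wpM2r ?invr_ge0 ?(ltW j0)// -mulNr.
apply: ler_pM; [lra|exact: expR_ge0|lra|].
by rewrite ler_expR lerN2 ler_piMr// ltW.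
Qed.
End Asymptotics.

(** * Positivity of the liminf in each regime *)

Section Liminf.
Variables (R : realType) (n : nat).
Implicit Types (lambda T a g M : R).

Lemma base_freq_itv g : 0 < g -> g^-1 <= pi / (2 * g) <= 2 / g.
Proof.
move=> g0; have -> : pi / (2 * g) = pi / 2 / g by move: (@pi R) => P; field; rewrite gt_eqF.
have := @pihalf_ge1 R; have /ltW := @pihalf_lt2 R => p2 p1.
by rewrite -[X in X <= _]mul1r !ler_wpM2r// invr_ge0 ltW.
Qed.

Lemma base_freq_gt0 g : 0 < g -> 0 < pi / (2 * g).
Proof. by move=> g0; rewrite divr_gt0 ?mulr_gt0 ?pi_gt0. Qed.

Lemma amplitude_ge g : 0 < g -> g ^+ n.+1 <= g * (2 * g) ^+ n * 2.
Proof.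
move=> g0; rewrite exprS -[leLHS]mulr1.
apply: ler_pM => //; rewrite ?mulr_ge0 ?exprn_ge0 ?(ltW g0) ?ler1n//.
by rewrite ler_wpM2l ?(ltW g0)// lerXn2r ?nnegrE ?mulr_ge0 ?(ltW g0)// ler_peMl ?(ltW g0)// ler1n.
Qed.

Lemma liminf_small_time_gt1 lambda g (T a : R -> R) : 1 < lambda < 2 -> 0 < g ->
  (forall M, 0 < M -> [/\ 0 < T M, 0 < a M & T M * a M = M]) ->
  (0 < limf_einf (fun M => Lip n.+1 lambda (T M) (a M) g / (M `^ lambda^-1 * `|ln M|)%:E) 0^'+)%E.
Proof.
move=> /andP[l1 l2] g0 Ta; have l0 : 0 < lambda := lt_trans ltr01 l1.
have K0 : 0 < g * (2 * g) ^+ n * 2 by rewrite !mulr_gt0// exprn_gt0// mulr_gt0.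
have t0 := base_freq_gt0 g0; set theta := pi / (2 * g) in t0.
(* The threshold on M^(-1/lambda) that gives both hypotheses of [single_mode_gt1]. *)
pose B := Num.max 4 (2 * theta).
have B0 : 0 < B by rewrite /B lt_max ltr0n.
have r0 : 0 < g * (2 * g) ^+ n * 2 * (expR (- 4) / (4 * lambda)).
  by rewrite mulr_gt0// divr_gt0 ?expR_gt0// mulr_gt0.
apply: (limf_einf_gt0 r0); near=> M.
have M0 : 0 < M by near: M; exact: nbhs_right_gt.
have MB : M <= B `^ (- lambda) by near: M; apply: nbhs_right_le; rewrite powR_gt0.
have [T0 a0 TE] := Ta M M0.
have XB : B <= M `^ (- lambda^-1).
  rewrite powRN -[leLHS]invrK lef_pV2 ?posrE ?invr_gt0 ?powR_gt0//.
  have -> : B^-1 = (B `^ (- lambda)) `^ lambda^-1.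
    by rewrite -powRrM mulNr mulfV ?gt_eqF// powR_inv1 ?(ltW B0).
  by apply: ge0_ler_powR; rewrite ?nnegrE ?powR_ge0 ?invr_ge0 ?(ltW M0) ?(ltW l0).
have X4 : 4 <= M `^ (- lambda^-1) by apply: le_trans XB; rewrite le_max lexx.
have Xt : theta <= M `^ (- lambda^-1) / 2.
  by rewrite ler_pdivlMr// mulrC; apply: le_trans XB; rewrite le_max lexx orbT.
have [k hk] := single_mode_gt1 (introT andP (conj l1 l2)) M0 t0 Xt X4.
apply: lee_div_ge (Lip_ge_single n k T0 a0 g0 l0).
  rewrite mulr_gt0 ?powR_gt0// normr_gt0.
  (* The normalization is nonzero: M = 1 would contradict [X4]. *)
  apply/eqP => lnM0; move: X4.
  have -> : M = 1 by rewrite -(lnK M0) lnM0 expR0.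
  by rewrite powR1 => ?; lra.
by rewrite TE -mulrA ler_wpM2l ?(ltW K0).
Unshelve. all: by end_near. Qed.

Lemma liminf_small_time_lt1 lambda g (T a : R -> R) : 0 < lambda < 1 -> 0 < g <= 2^-1 ->
  (forall M, 0 < M -> [/\ 0 < T M, 0 < a M & T M * a M = M]) ->
  (0 < limf_einf (fun M => Lip n.+1 lambda (T M) (a M) g / M%:E) 0^'+)%E.
Proof.
move=> /andP[l0 l1] /andP[g0 g2] Ta.
have K0 : 0 < g * (2 * g) ^+ n * 2 by rewrite !mulr_gt0// exprn_gt0// mulr_gt0.
(* This mode stays fixed as M tends to 0. Being at least 2, it has a nonzero logarithm, and the
   bound is linear in M. *)
pose f := freq g 0.
have f2 : 2 <= f.
  rewrite /f /freq mul1r; have /andP[+ _] := base_freq_itv g0; apply: le_trans.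
  by rewrite -[leLHS]invrK lef_pV2 ?posrE ?invr_gt0.
have f0 : 0 < f by lra.
have lf : 0 < `|ln f| by rewrite normr_gt0 gt_eqF// ln_gt0//; lra.
have r0 : 0 < g * (2 * g) ^+ n * 2 * (f `^ (lambda - 1) * `|ln f| * expR (- f `^ lambda)).
  by rewrite mulr_gt0// !mulr_gt0 ?expR_gt0 ?powR_gt0.
apply: (limf_einf_gt0 r0); near=> M.
have M0 : 0 < M by near: M; exact: nbhs_right_gt.
have M1 : M <= 1 by near: M; exact: nbhs_right_le.
have [T0 a0 TE] := Ta M M0.
apply: lee_div_ge (Lip_ge_single n 0 T0 a0 g0 l0) => //.
rewrite TE -/f -mulrA ler_wpM2l ?(ltW K0)//.
have -> : f `^ (lambda - 1) * `|ln f| * expR (- f `^ lambda) * M =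
   M * f `^ (lambda - 1) * `|ln f| * expR (- f `^ lambda) by ring.
rewrite ler_wpM2l ?mulr_ge0 ?powR_ge0 ?(ltW M0)// ler_expR lerN2.
by rewrite ler_piMl ?powR_ge0.
Unshelve. all: by end_near. Qed.

Lemma liminf_small_time_eq1 g (T a : R -> R) : 0 < g <= 2^-1 ->
  (forall M, 0 < M -> [/\ 0 < T M, 0 < a M & T M * a M = M]) ->
  (0 < limf_einf (fun M => Lip n.+1 1 (T M) (a M) g / (M * ln M ^+ 2)%:E) 0^'+)%E.
Proof.
move=> /andP[g0 g2] Ta; have ln20 := ln2_gt0 R.
have K0 : 0 < g * (2 * g) ^+ n * 2 by rewrite !mulr_gt0// exprn_gt0// mulr_gt0.
have t1 : 1 <= pi / (2 * g).
  have /andP[+ _] := base_freq_itv g0; apply: le_trans.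
  by rewrite -[leLHS]invrK lef_pV2 ?posrE ?invr_gt0// invr1; lra.
pose B := Num.max (2 * ln (2 * (pi / (2 * g)))) (4 * ln 2).
have r0 : 0 < g * (2 * g) ^+ n * 2 * (3^-1 * (expR (- 1) / 32)).
  by rewrite mulr_gt0// mulr_gt0 ?invr_gt0// divr_gt0 ?expR_gt0.
apply: (limf_einf_gt0 r0); near=> M.
have M0 : 0 < M by near: M; exact: nbhs_right_gt.
have MB : M <= expR (- B) by near: M; apply: nbhs_right_le; exact: expR_gt0.
have [T0 a0 TE] := Ta M M0.
have lB : B <= - ln M by rewrite lerNr -[leRHS]expRK ler_ln ?posrE ?expR_gt0.
have b1 : 2 * ln (2 * (pi / (2 * g))) <= - ln M by apply: le_trans lB; rewrite le_max lexx.
have b2 : 4 * ln 2 <= - ln M by apply: le_trans lB; rewrite le_max lexx orbT.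
have [N hN] := sum_modes_small_time M0 t1 b1 b2.
apply: lee_div_ge (Lip1_ge_sum n N T0 a0 g0).
  rewrite mulr_gt0// lt_neqAle sqr_ge0 andbT eq_sym sqrf_eq0.
  by apply/eqP => l0; move: b2; rewrite l0; lra.
rewrite TE -mulrA ler_wpM2l ?(ltW K0)//.
have -> : 3^-1 * (expR (- 1) / 32) * (M * ln M ^+ 2) = M / 3 * (expR (- 1) / 32 *
  ln M ^+ 2) by ring.
by rewrite ler_wpM2l ?divr_ge0 ?(ltW M0).
Unshelve. all: by end_near. Qed.

Lemma liminf_large_data_gt1 lambda T a : 1 < lambda < 2 -> 0 < T -> 0 < a ->
  (0 < limf_einf (fun g => Lip n.+1 lambda T a g / (g ^+ n.+1)%:E) (pinfty_nbhs R))%E.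
Proof.
move=> l12 T0 a0; have /andP[l1 l2] := l12; have l0 : 0 < lambda := lt_trans ltr01 l1.
have M0 : 0 < T * a by rewrite mulr_gt0.
have r0 : 0 < T * a * ln 2 * expR (- (64 * (T * a))) by rewrite !mulr_gt0 ?ln2_gt0 ?expR_gt0.
apply: (limf_einf_gt0 r0); near=> g.
have g1 : 1 <= g by near: g; apply: nbhs_pinfty_ge; exact: num_real.
have g0 : 0 < g by lra.
have t2 : 0 < pi / (2 * g) <= 2.
  rewrite base_freq_gt0//=; have /andP[_ h] := base_freq_itv g0; apply: le_trans h _.
  by rewrite ler_pdivrMr//; lra.
have [k hk] := single_mode_gt1_large l12 M0 t2.
apply: lee_div_ge (Lip_ge_single n k T0 a0 g0 l0); first by rewrite exprn_gt0.
by rewrite mulrC ler_pM ?amplitude_ge// ?exprn_ge0 ?(ltW g0) ?(ltW r0).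
Unshelve. all: by end_near. Qed.

Lemma liminf_large_data_lt1 lambda T a : 0 < lambda < 1 -> 0 < T -> 0 < a ->
  (0 < limf_einf (fun g => Lip n.+1 lambda T a g / (g `^ (n.+1%:R + 1 - lambda) * ln g)%:E)
         (pinfty_nbhs R))%E.
Proof.
move=> l01 T0 a0; have /andP[l0 l1] := l01; have ln20 := ln2_gt0 R.
have M0 : 0 < T * a by rewrite mulr_gt0.
have r0 : 0 < T * a * expR (- (T * a)) / 4 by rewrite divr_gt0// mulr_gt0 ?expR_gt0.
apply: (limf_einf_gt0 r0); near=> g.
have g4 : 4 <= g by near: g; apply: nbhs_pinfty_ge; exact: num_real.
have g0 : 0 < g by lra.
have lg0 : 0 < ln g by rewrite ln_gt0//; lra.
have t2 : 0 < pi / (2 * g) <= 2 / g by rewrite base_freq_gt0//=; have /andP[] := base_freq_itv g0.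
have hk := low_mode_lt1 l01 M0 g4 t2.
apply: lee_div_ge (Lip_ge_single n 0 T0 a0 g0 l0); first by rewrite mulr_gt0 ?powR_gt0.
rewrite /freq mul1r.
(* The amplitude supplies [g ^+ n.+1] and the lowest mode the remaining power. *)
have -> : g `^ (n.+1%:R + 1 - lambda) = g ^+ n.+1 * g `^ (1 - lambda).
  by rewrite -addrA powRD ?powR_mulrn ?(ltW g0)//; apply/implyP => _; rewrite gt_eqF.
rewrite -[X in _ * X]mulrA mulrCA.
have gl0 : 0 <= g `^ (1 - lambda) * ln g by rewrite mulr_ge0 ?powR_ge0 ?(ltW lg0).
apply: ler_pM; [by rewrite exprn_ge0 ?(ltW g0)|by rewrite mulr_ge0 ?(ltW r0)|exact:
  amplitude_ge|exact: hk].
Unshelve. all: by end_near. Qed.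

Lemma liminf_large_data_eq1 T a : 0 < T -> 0 < a ->
  (0 < limf_einf (fun g => Lip n.+1 1 T a g / (g ^+ n.+1 * ln g ^+ 2)%:E) (pinfty_nbhs R))%E.
Proof.
move=> T0 a0; have ln20 := ln2_gt0 R.
have M0 : 0 < T * a by rewrite mulr_gt0.
have r0 : 0 < T * a / 3 * (expR (- (T * a)) / 64) by rewrite mulr_gt0// divr_gt0 ?expR_gt0.
apply: (limf_einf_gt0 r0); near=> g.
(* With theta <= 2 / g, g >= 32 gives - ln theta >= ln g - ln 2 >= 4 ln 2. *)
have g32 : expR (5 * ln 2) <= g by near: g; apply: nbhs_pinfty_ge; exact: num_real.
have g0 : 0 < g := lt_le_trans (expR_gt0 _) g32.
have lg : 5 * ln 2 <= ln g by rewrite -[leLHS]expRK ler_ln ?posrE ?expR_gt0.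
have t0 := base_freq_gt0 g0.
have lt : ln (pi / (2 * g)) <= ln 2 - ln g.
  have /andP[_ t2] := base_freq_itv g0.
  by rewrite -ln_div ?posrE// ler_ln ?posrE// divr_gt0.
have h4 : 4 * ln 2 <= - ln (pi / (2 * g)) by lra.
have [N hN] := sum_modes_large_data M0 t0 h4.
apply: lee_div_ge (Lip1_ge_sum n N T0 a0 g0).
  by rewrite mulr_gt0 ?exprn_gt0//; lra.
rewrite mulrCA.
(* Since - ln theta >= ln g / 2, squaring costs the factor 4 between 16 and 64. *)
have lgt : expR (- (T * a)) / 64 * ln g ^+ 2 <= expR (- (T * a)) / 16 * ln (pi / (2 * g)) ^+ 2.
  have -> : expR (- (T * a)) / 64 * ln g ^+ 2 = expR (- (T * a)) / 16 * (2^-1 *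
    ln g) ^+ 2 by field.
  rewrite ler_wpM2l ?divr_ge0 ?expR_ge0// -[leRHS]sqrrN lerXn2r ?nnegrE; lra.
apply: ler_pM; [by rewrite exprn_ge0 ?(ltW g0)|by rewrite mulr_ge0 ?(ltW r0) ?sqr_ge0|exact:
  amplitude_ge|].
by rewrite -[leLHS]mulrA ler_wpM2l ?divr_ge0 ?(ltW M0)// (le_trans lgt).
Unshelve. all: by end_near. Qed.
End Liminf.

Unset Implicit Arguments.

Theorem proposition8p3 (R : realType) (d : nat) (lambda : R)
    (hd : (1 <= d)%N) (hlambda : 0 < lambda < 2) :
  exists M0 gamma0 : R, [/\ 0 < M0, 0 < gamma0,
    (* (i), for every way T = T(M), a = a(M) of realizing M = T a *)
    (forall gamma : R, 0 < gamma <= gamma0 ->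
     forall T a : R -> R,
       (forall M, 0 < M -> [/\ 0 < T M, 0 < a M & T M * a M = M]) ->
       (0 < limf_einf
              (fun M : R => Lip d lambda (T M) (a M) gamma
                            / (sigmaM lambda M)%:E)
              0^'+)%E) &
    (* (ii), with M = T a *)
    (forall T a : R, 0 < T -> 0 < a -> T * a <= M0 ->
       (0 < limf_einf
              (fun gamma : R => Lip d lambda T a gamma
                                / (sigmag d lambda gamma)%:E)
              (pinfty_nbhs R))%E)].
Proof.
case: d hd => // n _; have /andP[l0 l2] := hlambda.
(* In (i), [gamma <= 1/2] makes all test frequencies at least 2, so that their
   logarithms have the same sign. *)
exists 1, 2^-1; split=> //.
- move=> g g01 T a Ta; have /andP[g0 _] := g01; rewrite /sigmaM.
  have [l1|l1] := ltP 1 lambda.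
    by apply: liminf_small_time_gt1; rewrite ?l1.
  have [->|ln1] := eqVneq lambda 1; first exact: liminf_small_time_eq1.
  by apply: liminf_small_time_lt1 => //; rewrite l0 lt_neqAle ln1.
- move=> T a T0 a0 _; rewrite /sigmag.
  have [l1|l1] := ltP 1 lambda.
    by apply: liminf_large_data_gt1; rewrite ?l1.
  have [->|ln1] := eqVneq lambda 1; first exact: liminf_large_data_eq1.
  by apply: liminf_large_data_lt1 => //; rewrite l0 lt_neqAle ln1.
Qed.
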